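(* Let $X$ be a nonempty open bounded subset of $\mathbb{R}^n$. The set $C_{ae}(X,\mathbb{R})$ endowed with the metric $r$ is a complete metric space, and the subset $C^0(X,\mathbb{R})$ of (classes of) bounded continuous functions is dense in $C_{ae}(X,\mathbb{R})$.
   Context: $C_{ae}(X,\mathbb{R})$ is the set of equivalence classes of bounded functions $X\to\mathbb{R}$ that are continuous at almost every point, two functions being equivalent if they coincide almost everywhere; $f\le g$ means $\varphi\le\psi$ a.e. for representatives. For $k\in\mathbb{N}$, $f_k^-=\sup\{\varphi\in Lip_k(X,\mathbb{R}):\varphi\le f\}$ and $f_k^+=\inf\{\varphi\in Lip_k(X,\mathbb{R}):\varphi\ge f\}$, $Lip_k$ being the $k$-Lipschitz functions. For bounded continuous $\varphi,\psi$ let $h(\varphi,\psi)$ be the Hausdorff distance between closures of their graphs in $\mathrm{cl}X\times\mathbb{R}$ and $\delta(\varphi,\psi)=h(\varphi,\psi)+\int_X|\varphi(x)-\psi(x)|\,dx$. Then $r(f,g)=\sup_{k\in\mathbb{N}}\max\{\delta(f_k^-,g_k^-),\delta(f_k^+,g_k^+)\}$. *)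

(* Defs.v *)
From HB Require Import structures.
From mathcomp Require Import all_boot all_order all_algebra.
From mathcomp Require Import all_classical all_reals all_analysis.
Set Implicit Arguments.
Unset Strict Implicit.
Unset Printing Implicit Defensive.
Import Order.TTheory GRing.Theory Num.Theory.
Import numFieldNormedType.Exports.
Local Open Scope classical_set_scope.
Local Open Scope ring_scope.

Section Defs.
Variables (R : realType) (n : nat).

Notation pt := 'rV[R]_n.

Definition enorm (x : pt) : R := Num.sqrt (\sum_(i < n) x ord0 i ^+ 2).
Definition edist (x y : pt) : R := enorm (x - y).
Definition edist1 (p q : pt * R) : R :=
  Num.sqrt (\sum_(i < n) (p.1 ord0 i - q.1 ord0 i) ^+ 2 + (p.2 - q.2) ^+ 2).

Definition rbox (a b : pt) : set pt := [set x | forall i, a ord0 i <= x ord0 i <= b ord0 i].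
Definition box_vol (a b : pt) : R := \prod_(i < n) Num.max (b ord0 i - a ord0 i) 0.

Definition box_content (A : set pt) : \bar R :=
  if `[< A = set0 >] then 0%E
  else ereal_inf [set (box_vol ab.1 ab.2)%:E | ab in [set ab : pt * pt | A `<=` rbox ab.1 ab.2]].

Lemma box_content0 : box_content set0 = 0%E.
Proof. by rewrite /box_content asboolT. Qed.

Lemma box_content_ge0 (A : set pt) : (0 <= box_content A)%E.
Proof.
rewrite /box_content; case: ifP => // _.
apply: le_ereal_inf_tmp => _ [ab _ <-]; rewrite lee_fin.
by apply: prodr_ge0 => i _; rewrite le_max lexx orbT.
Qed.

(* every subset of R^n is declared measurable here; only used to build the
   outer measure through mathcomp's [mu_ext] *)
Definition allsets := g_sigma_algebraType (@setT (set pt)).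

(* Lebesgue outer measure on R^n:
   inf { sum_k |B_k| : A `<=` \bigcup_k F_k, F_k `<=` rbox B_k } *)
Definition leb_outer : set pt -> \bar R :=
  mu_ext (box_content : set allsets -> \bar R).

HB.instance Definition _ := isOuterMeasure.Build R pt leb_outer
  (@mu_ext0 _ allsets R box_content box_content0 box_content_ge0)
  (@mu_ext_ge0 _ allsets R box_content box_content_ge0)
  (@le_mu_ext _ allsets R box_content)
  (@mu_ext_sigma_subadditive _ allsets R box_content box_content_ge0).

(* the (complete) Lebesgue measure on R^n: restriction of the outer measure
   to the Caratheodory-measurable sets *)
Definition Leb_space := caratheodory_type leb_outer.
Definition Leb : set Leb_space -> \bar R := leb_outer.

Variable X : set pt.

Definition ale_on (f g : pt -> R) : Prop := leb_outer [set x | X x /\ g x < f x] = 0%E.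
Definition aeq_on (f g : pt -> R) : Prop := leb_outer [set x | X x /\ f x != g x] = 0%E.

Definition bounded_on (f : pt -> R) : Prop := exists M : R, forall x, X x -> `|f x| <= M.

(* representatives of elements of C_ae(X,R): bounded functions on X that
   are continuous at almost every point of X *)
Definition Cae (f : pt -> R) : Prop :=
  bounded_on f /\ leb_outer [set x | X x /\ ~ {for x, continuous f}] = 0%E.

Definition C0b (f : pt -> R) : Prop :=
  bounded_on f /\ forall x, X x -> {for x, continuous f}.

Definition LipOn (k : R) (phi : pt -> R) : Prop :=
  forall x y, X x -> X y -> `|phi x - phi y| <= k * edist x y.

Definition lower_env (k : nat) (f : pt -> R) : pt -> R :=
  fun x => sup [set phi x | phi in [set phi | LipOn k%:R phi /\ ale_on phi f]].
Definition upper_env (k : nat) (f : pt -> R) : pt -> R :=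
  fun x => inf [set phi x | phi in [set phi | LipOn k%:R phi /\ ale_on f phi]].

Definition graph_on (phi : pt -> R) : set (pt * R) := [set (x, phi x) | x in X].

Definition hausdorff_dist (A B : set (pt * R)) : \bar R :=
  Order.max
    (ereal_sup [set ereal_inf [set (edist1 p q)%:E | q in B] | p in A])
    (ereal_sup [set ereal_inf [set (edist1 p q)%:E | q in A] | p in B]).

Definition hdist (phi psi : pt -> R) : \bar R :=
  hausdorff_dist (closure (graph_on phi)) (closure (graph_on psi)).

Definition delta_dist (phi psi : pt -> R) : \bar R :=
  (hdist phi psi + \int[Leb]_(x in (X : set Leb_space)) (`|phi x - psi x|)%:E)%E.

Definition r_dist (f g : pt -> R) : \bar R :=
  ereal_sup [set Order.max (delta_dist (lower_env k f) (lower_env k g))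
                           (delta_dist (upper_env k f) (upper_env k g))
            | k in [set k : nat | (0 < k)%N]].

End Defs.

(* Main.v *)
Require Import Defs.
From HB Require Import structures.
From mathcomp Require Import all_boot all_order all_algebra.
From mathcomp Require Import all_classical all_reals all_analysis.
From mathcomp Require Import measurable_realfun ring lra.
Import Order.TTheory GRing.Theory Num.Theory.
Import numFieldNormedType.Exports.
Set Implicit Arguments.
Unset Strict Implicit.
Unset Printing Implicit Defensive.
Local Open Scope classical_set_scope.
Local Open Scope ring_scope.

(** The set [D] of continuity points of [f] has full measure, hence is dense, and on
[X] the lower envelope is the inf-convolution
[f_k^-(x) = inf_{z in D} f(z) + k |x - z|]; the upper one is obtained by negation.

Completeness: for a Cauchy sequence the k-th envelopes converge uniformly, to [F_k]
and [G_k] say, and [sup_k F_k] and [inf_k G_k] agree almost everywhere because the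
convergence of the integrals is uniform in [k].  Let [f] be the supremum of the
[F_k].  That [F_k] is the k-th lower envelope of [f] uses the Hausdorff part of the
distance between the upper envelopes: no compactness up to the boundary is available.

Density: envelopes with constant slope need not converge for [r], since near the
boundary [X] may be badly disconnected.  One takes [phi(x)] to be the envelope of [f]
at [x] with slope [kap(x)], where [kap] tends to infinity at the boundary, fast enough
with respect to the widths of the peaks and dips of [f].  The graphs of the k-th
envelopes of [f] and [phi] are compared by translating the points and applying the
intermediate value theorem on segments contained in [X]. *)

Local Notation dist := Defs.edist.

(** The supremum over [k] in [r_dist] shapes both halves: Hausdorff closeness of [k]-Lipschitz
    functions gives uniform closeness only with a factor [1 + k], so a uniform argument for one
    slope says nothing about all slopes at once. The integrals are tamed by monotonicity: beyond a
    slope [K] everything is squeezed between the two [K]-th envelopes of [f], whose gap has small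
    integral. The Hausdorff part of the density rests on one estimate. A near-minimizer [y] of an
    inf-convolution at [x] has penalty [k |x - y| <= 2 M + e]. If replacing [y] by a partner [z]
    changes the penalty by more than [e], then [k |y - z| > e], whence
    [|x - y| <= (2 M + e) / e * |y - z|]: the point [x] lies as near to [y] as the displacement
    allows. When [|y - z|] is at most [e / (4 (M + e))] times some scale at [y], then
    [|x - y| + |y - z|] is at most half of that scale, whatever [k] is. Choosing the scales
    (distance to the boundary, widths of dips, widths of peaks) is then the whole matter. *)

(** * Euclidean geometry *)

Section Euclid.
Variable R : realType.

Lemma minkowski2 (a b c d : R) :
  Num.sqrt ((a + b) ^+ 2 + (c + d) ^+ 2) <=
  Num.sqrt (a ^+ 2 + c ^+ 2) + Num.sqrt (b ^+ 2 + d ^+ 2).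
Proof.
have p0 : 0 <= a ^+ 2 + c ^+ 2 by rewrite addr_ge0 ?sqr_ge0.
have q0 : 0 <= b ^+ 2 + d ^+ 2 by rewrite addr_ge0 ?sqr_ge0.
have := sqr_sqrtr p0; have := sqr_sqrtr q0.
have := sqrtr_ge0 (a ^+ 2 + c ^+ 2); have := sqrtr_ge0 (b ^+ 2 + d ^+ 2).
set s := Num.sqrt (a ^+ 2 + _); set t := Num.sqrt (b ^+ 2 + _) => t0 s0 tE sE.
rewrite -(@ler_sqr _ _ (s + t)) ?nnegrE ?sqrtr_ge0 ?addr_ge0//.
rewrite sqr_sqrtr; last by rewrite addr_ge0 ?sqr_ge0.
suff : a * b + c * d <= s * t by nra.
have [h|/ltW h] := leP (a * b + c * d) 0; first by rewrite (le_trans h)// mulr_ge0.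
rewrite -ler_sqr ?nnegrE ?mulr_ge0// exprMn sE tE.
by have := sqr_ge0 (a * d - b * c); nra.
Qed.

(** Induction on the dimension: the planar case is applied to the norm of the first [n] coordinates
    and to the last coordinate. *)
Lemma minkowski n (x y : 'I_n -> R) :
  Num.sqrt (\sum_(i < n) (x i + y i) ^+ 2) <=
  Num.sqrt (\sum_(i < n) x i ^+ 2) + Num.sqrt (\sum_(i < n) y i ^+ 2).
Proof.
have s0 m (z : 'I_m -> R) : 0 <= \sum_(i < m) z i ^+ 2.
  by apply: sumr_ge0 => i _; exact: sqr_ge0.
elim: n x y => [|n IH] x y; first by rewrite !big_ord0 !sqrtr0 addr0.
rewrite !big_ord_recr/=.
set x' := fun i : 'I_n => x (widen_ord (leqnSn n) i).
set y' := fun i : 'I_n => y (widen_ord (leqnSn n) i).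
have := minkowski2 (Num.sqrt (\sum_(i < n) x' i ^+ 2))
  (Num.sqrt (\sum_(i < n) y' i ^+ 2)) (x ord_max) (y ord_max).
rewrite !sqr_sqrtr//; apply: le_trans.
rewrite ler_wsqrtr// lerD2r.
rewrite -[leLHS](sqr_sqrtr (s0 _ (fun i => x' i + y' i))).
by rewrite ler_sqr ?nnegrE ?addr_ge0 ?sqrtr_ge0//; exact: IH.
Qed.

Variable n : nat.
Implicit Types x y z v : 'rV[R]_n.

Lemma dist_ge0 x y : 0 <= dist x y.
Proof. exact: sqrtr_ge0. Qed.

Lemma distxx x : dist x x = 0.
Proof.
rewrite /Defs.edist /enorm big1 ?sqrtr0// => i _.
by rewrite !mxE subrr expr0n.
Qed.

Lemma distC x y : dist x y = dist y x.
Proof.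
rewrite /Defs.edist /enorm; congr Num.sqrt; apply: eq_bigr => i _.
by rewrite !mxE -sqrrN opprB.
Qed.

Lemma dist_tri y x z : dist x z <= dist x y + dist y z.
Proof.
rewrite /Defs.edist /enorm; apply: le_trans (minkowski _ _).
rewrite le_eqVlt; apply/orP; left; apply/eqP; congr Num.sqrt; apply: eq_bigr => i _.
by rewrite !mxE; congr (_ ^+ 2); ring.
Qed.

Lemma distDr v x y : dist (x + v) (y + v) = dist x y.
Proof. by rewrite /Defs.edist opprD addrACA subrr addr0. Qed.

Lemma dist_addv v x : dist x (x + v) = enorm v.
Proof. by rewrite distC /Defs.edist addrAC subrr add0r. Qed.

Lemma enormZ (t : R) v : enorm (t *: v) = `|t| * enorm v.
Proof.
rewrite /enorm -sqrtr_sqr -sqrtrM ?sqr_ge0// mulr_sumr; congr Num.sqrt.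
by apply: eq_bigr => i _; rewrite mxE exprMn.
Qed.

Lemma coord_le_norm v i : `|v ord0 i| <= `|v|.
Proof.
rewrite [leRHS]/Num.Def.normr/= mx_normrE; apply/bigmax_geP; right => /=.
by exists (ord0, i).
Qed.

Lemma norm_le_enorm v : `|v| <= enorm v.
Proof.
rewrite [leLHS]/Num.Def.normr/= mx_normrE; apply/bigmax_leP; split; first exact: sqrtr_ge0.
move=> [i j] _ /=; rewrite ord1 -sqrtr_sqr ler_wsqrtr// (bigD1 j)//= lerDl.
by apply: sumr_ge0 => k _; exact: sqr_ge0.
Qed.

(** The factor is crude but positive also for [n = 0], so that it can be divided by. *)
Lemma enorm_le_norm v : enorm v <= n.+1%:R * `|v|.
Proof.
rewrite /enorm -(ger0_norm (_ : 0 <= n.+1%:R * `|v|)) ?mulr_ge0//.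
rewrite -sqrtr_sqr ler_wsqrtr// (@le_trans _ _ (\sum_(i < n) `|v| ^+ 2))//.
  apply: ler_sum => i _; rewrite -[leLHS]real_normK ?num_real//.
  by rewrite lerXn2r ?nnegrE// coord_le_norm.
rewrite sumr_const card_ord exprMn -[leLHS]mulr_natl ler_wpM2r ?sqr_ge0//.
by rewrite -natrX ler_nat expnS expn1 mulSn (leq_trans (leqnSn n))// leq_addr.
Qed.

(** The topology on row vectors comes from the sup norm; the two norm comparisons allow every later
    topological argument to use the Euclidean [dist]. *)
Lemma nbhs_dist x (A : set 'rV[R]_n) :
  nbhs x A <-> exists2 e : R, 0 < e & forall y, dist x y < e -> A y.
Proof.
split=> [/nbhs_ballP[e e0 xA]|[e e0 xA]].
  exists e => // y xy; apply: xA; rewrite mx_norm_ball /ball_/=.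
  exact: le_lt_trans (norm_le_enorm _) xy.
apply/nbhs_ballP; exists (e / n.+1%:R); first by rewrite /= divr_gt0.
move=> y; rewrite mx_norm_ball /ball_/= ltr_pdivlMr// => xy; apply: xA.
by rewrite (le_lt_trans (enorm_le_norm _))// mulrC.
Qed.

Lemma open_dist (A : set 'rV[R]_n) :
  open A <-> forall x, A x -> exists2 e : R, 0 < e & forall y, dist x y < e -> A y.
Proof.
rewrite openE; split=> [oA x Ax|h x Ax]; first by apply/nbhs_dist; exact: oA.
by apply/nbhs_dist; exact: h.
Qed.

Lemma continuous_dist (f : 'rV[R]_n -> R) x :
  {for x, continuous f} <->
  forall e, 0 < e -> exists2 d, 0 < d & forall y, dist x y < d -> `|f x - f y| < e.
Proof.
split=> [/(@cvgrPdist_lt _ _ _ (nbhs x)) fx e e0|h].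
  by have /nbhs_dist := fx _ e0.
apply/(@cvgrPdist_lt _ _ _ (nbhs x)) => e e0; apply/nbhs_dist; exact: h.
Qed.

Implicit Types p q r : 'rV[R]_n * R.

Lemma edist1E p q : edist1 p q = Num.sqrt (dist p.1 q.1 ^+ 2 + (p.2 - q.2) ^+ 2).
Proof.
rewrite /edist1 /Defs.edist /enorm sqr_sqrtr; last first.
  by apply: sumr_ge0 => i _; exact: sqr_ge0.
by congr (Num.sqrt (_ + _)); apply: eq_bigr => i _; rewrite !mxE.
Qed.

Lemma edist1_ge0 p q : 0 <= edist1 p q.
Proof. exact: sqrtr_ge0. Qed.

Lemma edist1_tri q p r : edist1 p r <= edist1 p q + edist1 q r.
Proof.
rewrite !edist1E; apply: le_trans (minkowski2 _ _ _ _).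
have -> : p.2 - r.2 = (p.2 - q.2) + (q.2 - r.2) by ring.
rewrite ler_wsqrtr// lerD2r ler_sqr ?nnegrE ?addr_ge0 ?dist_ge0//.
exact: dist_tri.
Qed.

Lemma dist_le_edist1 p q : dist p.1 q.1 <= edist1 p q.
Proof.
rewrite edist1E -[leLHS]ger0_norm ?dist_ge0// -sqrtr_sqr ler_wsqrtr//.
by rewrite lerDl sqr_ge0.
Qed.

Lemma gap_le_edist1 p q : `|p.2 - q.2| <= edist1 p q.
Proof. by rewrite edist1E -sqrtr_sqr ler_wsqrtr// lerDr sqr_ge0. Qed.

Lemma edist1_le p q : edist1 p q <= dist p.1 q.1 + `|p.2 - q.2|.
Proof.
have d0 := dist_ge0 p.1 q.1.
rewrite edist1E -[leRHS]ger0_norm ?addr_ge0//.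
rewrite -sqrtr_sqr ler_wsqrtr// -[(p.2 - _) ^+ 2]real_normK ?num_real// sqrrD.
by rewrite -addrA lerD2l lerDr mulrn_wge0// mulr_ge0.
Qed.

Lemma closure_edist1 (A : set ('rV[R]_n * R)) p :
  closure A p <-> forall e, 0 < e -> exists2 q, A q & edist1 p q < e.
Proof.
split=> [cA e e0|h B].
  pose U := [set y | dist p.1 y < e / 2]; pose V := [set t : R | `|p.2 - t| < e / 2].
  have e2 : 0 < e / 2 by rewrite divr_gt0.
  have : nbhs p [set q | U q.1 /\ V q.2].
    exists (U, V) => /=; last by move=> q [].
    split; first by apply/nbhs_dist; exists (e / 2).
    by apply/nbhs_normP; exists (e / 2).
  move=> /cA[q [Aq [Uq Vq]]]; exists q => //; rewrite (le_lt_trans (edist1_le _ _))//.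
  by rewrite (splitr e) ltrD.
move=> [[U V] /= [/nbhs_dist[d d0 dU] /nbhs_normP[g /= g0 gV]] UVB].
have m0 : 0 < Num.min d g by rewrite lt_min d0.
have [q Aq] := h _ m0; rewrite lt_min => /andP[pd pg].
exists q; split=> //; apply: UVB; split => /=.
  by apply: dU; rewrite (le_lt_trans (dist_le_edist1 _ _)).
by apply: gV => /=; rewrite (le_lt_trans (gap_le_edist1 _ _)).
Qed.

End Euclid.

(** * Volumes of boxes and Lebesgue outer measure *)

Section BoxCover.
Variable R : realType.

Lemma integral_itv_indic (c a b : R) : 0 <= c ->
  (\int[lebesgue_measure]_t (c * \1_(`[a, b]%classic) t)%:E =
   (c * Num.max (b - a) 0)%:E)%E.
Proof.
move=> c0; under eq_integral do rewrite EFinM.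
rewrite ge0_integralZl_EFin//; last by apply/measurable_EFinP.
rewrite integral_indic// setIT.
transitivity (c%:E * (if (a < b)%R then b%:E - a%:E else 0))%E.
  by congr (_ * _)%E; have := lebesgue_measure_itv `[a, b]; rewrite /= lte_fin.
have [ab|ba] := ltP a b; last by rewrite max_r ?subr_le0// mulr0 mule0.
by rewrite max_l ?subr_ge0 ?ltW// -EFinB -EFinM.
Qed.

(* A pointwise domination of indicators of boxes is integrated one coordinate
   at a time; [c k] absorbs the coordinates that are still frozen. *)
Lemma box_vol_series (n : nat) (c : nat -> R) (a b : nat -> nat -> R)
    (c0 : R) (a0 b0 : nat -> R) : 0 <= c0 -> (forall k, 0 <= c k) ->
  (forall x : nat -> R,
    ((c0 * \prod_(0 <= i < n) \1_(`[a0 i, b0 i]%classic) (x i))%:E <=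
     \sum_(k <oo) (c k * \prod_(0 <= i < n) \1_(`[a k i, b k i]%classic) (x i))%:E)%E) ->
  ((c0 * \prod_(0 <= i < n) Num.max (b0 i - a0 i) 0)%:E <=
   \sum_(k <oo) (c k * \prod_(0 <= i < n) Num.max (b k i - a k i) 0)%:E)%E.
Proof.
elim: n c c0 => [|n IH] c c0 c00 c_ge0 H.
  have := H (fun=> 0); rewrite !big_geq//.
  by under eq_eseriesr do rewrite big_geq//;
     under [in X in _ -> X]eq_eseriesr do rewrite big_geq//.
have V0 (u v : nat -> R) : 0 <= \prod_(0 <= i < n) Num.max (v i - u i) 0.
  by apply: prodr_ge0 => i _; rewrite le_max lexx orbT.
(* Freezing the last coordinate at [t] turns its indicators into nonnegative constants, to which the
   induction hypothesis applies; the result is then integrated over [t], exchanging sum and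
   integral. *)
have step t : ((c0 * \prod_(0 <= i < n) Num.max (b0 i - a0 i) 0 *
      \1_(`[a0 n, b0 n]%classic) t)%:E <=
    \sum_(k <oo) (c k * \prod_(0 <= i < n) Num.max (b k i - a k i) 0 *
      \1_(`[a k n, b k n]%classic) t)%:E)%E.
  rewrite mulrAC; under eq_eseriesr do rewrite mulrAC.
  apply: IH => [|k|x]; rewrite ?mulr_ge0//.
  have := H (fun i => if i == n then t else x i).
  have E (u v : nat -> R) : \prod_(0 <= i < n.+1)
      \1_(`[u i, v i]%classic) (if i == n then t else x i) =
      \1_(`[u n, v n]%classic) t * \prod_(0 <= i < n) \1_(`[u i, v i]%classic) (x i) :> R.
    rewrite big_nat_recr//= eqxx mulrC; congr (_ * _).
    by apply: eq_big_nat => i /andP[_ /ltn_eqF ->].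
  by rewrite E mulrA; under eq_eseriesr do rewrite E mulrA.
rewrite big_nat_recr//= mulrA -integral_itv_indic ?mulr_ge0//.
under eq_eseriesr do rewrite big_nat_recr//= mulrA -integral_itv_indic ?mulr_ge0//.
rewrite -integral_nneseries//; last 2 first.
- move=> k; apply/measurable_EFinP; apply: measurable_funM => //.
- by move=> k x _; rewrite lee_fin !mulr_ge0.
apply: ge0_le_integral.
- exact: measurableT.
- by move=> x _; rewrite lee_fin !mulr_ge0.
- by apply/measurable_EFinP; apply: measurable_funM.
- apply: ge0_emeasurable_sum => [k x _ _|k _]; first by rewrite lee_fin !mulr_ge0.
  by apply/measurable_EFinP; apply: measurable_funM.
- by move=> x _; exact: step.
Qed.

Variable n : nat.
Implicit Types (A F : set 'rV[R]_n) (a b : 'rV[R]_n).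

Lemma box_content_le F a b : F `<=` rbox a b -> (box_content F <= (box_vol a b)%:E)%E.
Proof.
move=> Fab; rewrite /box_content; case: ifP => _.
  by rewrite lee_fin; apply: prodr_ge0 => i _; rewrite le_max lexx orbT.
by apply: ereal_inf_lbound; exists (a, b).
Qed.

(** [box_vol_series] indexes coordinates by [nat]; [insub] converts, and its default [0] is never
    reached since [i < n] in the product. *)
Lemma indic_rbox a b (x : nat -> R) :
  \prod_(0 <= i < n) \1_(`[if insub i is Some j then a ord0 j else 0,
                           if insub i is Some j then b ord0 j else 0]%classic) (x i) =
  \1_(rbox a b) (\row_j x j) :> R.
Proof.
rewrite big_mkord; rewrite [RHS]indicE.
have [/set_mem h|h] := boolP (_ \in rbox a b).
  by rewrite big1// => i _; rewrite valK indicE mem_set//= in_itv/=;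
     have := h i; rewrite mxE.
have /existsNP[i hi] : ~ rbox a b (\row_j x j) by move=> /mem_set; apply/negP.
rewrite (bigD1 i)//= valK indicE memNset ?mul0r// => /=; rewrite in_itv/= => abx.
by apply: hi; rewrite mxE.
Qed.

Lemma box_volE a b :
  \prod_(0 <= i < n) Num.max ((if insub i is Some j then b ord0 j else 0)
                    - (if insub i is Some j then a ord0 j else 0)) 0 = box_vol a b.
Proof. by rewrite big_mkord; apply: eq_bigr => i _; rewrite valK. Qed.

(** The nontrivial half of the volume formula. Each covering set is enclosed in a nearly optimal
    box; the indicator of the given box is then at most the sum of the indicators of these boxes,
    and integrating coordinate by coordinate compares the volumes. *)
Lemma box_vol_le_leb_outer a b : ((box_vol a b)%:E <= leb_outer (rbox a b))%E.
Proof.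
apply: le_ereal_inf_tmp => _ [F [_ abF] <-].
apply/lee_addgt0Pr => e e0.
have [[k Fk]|/forallNP Foo] := pselect (exists k, box_content (F k) = +oo%E).
  by rewrite (nneseries_pinfty _ _ Fk) ?leey// => i _; exact: box_content_ge0.
apply: le_trans (epsilon_trick _ _ (ltW e0)); last first.
  by move=> k; exact: box_content_ge0.
(* The first component is a weight: 1 in general and 0 for an empty [F k], since in dimension 0
   every box has volume 1 and none would be small enough. *)
have [G HG] : {G : nat -> R * ('rV[R]_n * 'rV[R]_n) & forall k,
    [/\ 0 <= (G k).1, forall x, F k x -> (G k).1 = 1 /\ rbox (G k).2.1 (G k).2.2 x &
      (((G k).1 * box_vol (G k).2.1 (G k).2.2)%:E <=
        box_content (F k) + (e / (2 ^ k.+1)%:R)%:E)%E]}.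
  apply: (@choice _ _ (fun k (g : R * ('rV[R]_n * 'rV[R]_n)) =>
    [/\ 0 <= g.1, forall x, F k x -> g.1 = 1 /\ rbox g.2.1 g.2.2 x &
      ((g.1 * box_vol g.2.1 g.2.2)%:E <=
        box_content (F k) + (e / (2 ^ k.+1)%:R)%:E)%E])) => k.
  have ek : 0 < e / (2 ^ k.+1)%:R by rewrite divr_gt0// ltr0n expn_gt0.
  have [F0|F0] := pselect (F k = set0).
    exists (0, (0, 0)); split=> //=; first by rewrite F0.
    by rewrite mul0r adde_ge0 ?box_content_ge0// lee_fin ltW.
  have bfin : box_content (F k) \is a fin_num.
    by rewrite ge0_fin_numE ?box_content_ge0// ltey; apply/eqP; exact: Foo.
  move: bfin; rewrite /box_content asboolF// => /(lb_ereal_inf_adherent ek).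
  move=> [_ [[u v] /= Fuv <-] /ltW h]; exists (1, (u, v)); split => //=.
  - by move=> x /Fuv.
  - by rewrite mul1r.
have := @box_vol_series n (fun k => (G k).1)
  (fun k i => if insub i is Some j then (G k).2.1 ord0 j else 0)
  (fun k i => if insub i is Some j then (G k).2.2 ord0 j else 0) 1
  (fun i => if insub i is Some j then a ord0 j else 0)
  (fun i => if insub i is Some j then b ord0 j else 0) ler01.
rewrite mul1r box_volE => /(_ _ _)/le_trans; apply.
- by move=> k; have [] := HG k.
- move=> x; rewrite mul1r indic_rbox indicE.
  have G0 k : (0 <= ((G k).1 * \prod_(0 <= i < n)
      \1_(`[if insub i is Some j then (G k).2.1 ord0 j else 0,
            if insub i is Some j then (G k).2.2 ord0 j else 0]%classic) (x i))%:E)%E.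
    by rewrite lee_fin indic_rbox mulr_ge0//; have [] := HG k.
  have [/set_mem/abF[k _ Fkx]|_] := boolP (_ \in rbox a b); last first.
    exact: nneseries_ge0.
  rewrite (@nneseriesD1 _ _ k xpredT)// -[leLHS]adde0; apply: leeD; last first.
    by apply: nneseries_ge0.
  have [_ /(_ _ Fkx)[-> Gx] _] := HG k.
  by rewrite mul1r indic_rbox indicE mem_set.
- apply: lee_nneseries => k _; last by rewrite box_volE; have [] := HG k.
  move=> _; rewrite lee_fin mulr_ge0//; first by have [] := HG k.
  by apply: prodr_ge0 => i _; rewrite le_max lexx orbT.
Qed.

End BoxCover.

(** * Lebesgue outer measure: balls are not null, open sets are measurable *)

Section LebOuter.
Variables (R : realType) (n : nat).
Implicit Types (A B F : set 'rV[R]_n) (x y : 'rV[R]_n).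

Lemma leb_outer_ball_gt0 x (e : R) : 0 < e ->
  (0 < leb_outer [set y | (dist x y < e)%R])%E.
Proof.
move=> e0; pose d := e / (n.+1%:R * 2); have d0 : 0 < d by rewrite divr_gt0// mulr_gt0.
have V0 : 0 < box_vol (x - const_mx d) (x + const_mx d).
  apply: prodr_gt0 => i _; rewrite !mxE lt_max; apply/orP; left; lra.
apply: (@lt_le_trans _ _ (box_vol (x - const_mx d) (x + const_mx d))%:E).
  by rewrite lte_fin.
apply: le_trans (box_vol_le_leb_outer _ _) _; apply: le_outer_measure => y /= xy.
rewrite (le_lt_trans (enorm_le_norm _))//.
suff h : `|x - y| <= d.
  apply: (@le_lt_trans _ _ (n.+1%:R * d)); first by rewrite ler_wpM2l.
  have -> : n.+1%:R * d = e / 2 by rewrite /d; field; rewrite nat1r pnatr_eq0.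
  lra.
rewrite [leLHS]/Num.Def.normr/= mx_normrE; apply/bigmax_leP; split; first exact: ltW.
move=> [i j] _ /=; rewrite ord1 !mxE; have := xy j; rewrite !mxE ler_norml.
by move=> /andP[? ?]; apply/andP; split; lra.
Qed.

Lemma leb_outer_le_content A : (leb_outer A <= box_content A)%E.
Proof.
apply: ereal_inf_lbound; exists (fun k : nat => if k == 0%N then A else set0).
  split=> [i|x Ax]; first exact: sub_sigma_algebra.
  by exists 0%N.
rewrite nneseries_recl//; last by move=> k _; exact: box_content_ge0.
by rewrite eseries0 ?adde0// => -[|k] //= _ _; rewrite box_content0.
Qed.

Lemma leb_outer_bounded A : bounded_set A -> (leb_outer A < +oo)%E.
Proof.
move=> /ex_strict_bound_gt0 [M M0 AM].
apply: le_lt_trans (leb_outer_le_content _) _.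
apply: le_lt_trans (_ : (box_vol (- const_mx M : 'rV[R]_n) (const_mx M))%:E < +oo)%E; last exact: ltry.
apply: box_content_le => x Ax i; rewrite !mxE -ler_norml.
by rewrite (le_trans (coord_le_norm _ _))// ltW//; exact: AM.
Qed.

(** A hyperplane cuts an enclosing box into two boxes that differ from it in side [i] only, and the
    lengths of the two sides add up to at most the original one. *)
Lemma box_content_split F (i : 'I_n) (c : R) :
  (box_content (F `&` [set x | (x ord0 i <= c)%R]) +
   box_content (F `&` ~` [set x | (x ord0 i <= c)%R]) <= box_content F)%E.
Proof.
have [->|F0] := pselect (F = set0); first by rewrite !set0I box_content0 adde0.
rewrite {3}/box_content asboolF//; apply: le_ereal_inf_tmp => _ [[a b] /= Fab <-].
pose b' : 'rV[R]_n := \row_j (if j == i then Num.min (b ord0 j) c else b ord0 j).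
pose a' : 'rV[R]_n := \row_j (if j == i then Num.max (a ord0 j) c else a ord0 j).
apply: (@le_trans _ _ ((box_vol a b')%:E + (box_vol a' b)%:E)%E).
  apply: leeD; apply: box_content_le => x /= [/Fab xab xc] j; rewrite mxE;
    have /andP[xa xb] := xab j; case: eqP => [ji|_]; rewrite ?xa ?xb ?andbT//=.
  - by subst j; rewrite le_min xb.
  - by subst j; rewrite ge_max xa/= ltW// ltNge; apply/negP.
rewrite -EFinD lee_fin /box_vol (bigD1 i)//= [X in _ + X](bigD1 i)//= [leRHS](bigD1 i)//=.
rewrite !mxE eqxx.
under eq_bigr => j ji do rewrite !mxE (negbTE ji).
under [X in _ + _ * X]eq_bigr => j ji do rewrite !mxE (negbTE ji).
rewrite -mulrDl ler_wpM2r//; first by apply: prodr_ge0 => j _; rewrite le_max lexx orbT.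
have [|] := leP (b ord0 i) c; have [|] := leP (a ord0 i) c => ac bc;
  rewrite /Num.max; do ?case: ifPn; rewrite -?leNgt => *; lra.
Qed.

HB.instance Definition _ := isMeasure.Build _ (Leb_space R n) R (@Leb R n)
  (@caratheodory_measure0 R _ (@leb_outer R n))
  (@caratheodory_measure_ge0 R _ (@leb_outer R n))
  (@caratheodory_measure_sigma_additive R _ (@leb_outer R n)).

(** Caratheodory's criterion: any cover of a test set splits along the hyperplane into two covers of
    no larger total content. *)
Lemma measurable_halfspace (i : 'I_n) (c : R) :
  measurable ([set x : 'rV[R]_n | x ord0 i <= c] : set (Leb_space R n)).
Proof.
apply: le_caratheodory_measurable => X.
apply: le_ereal_inf_tmp => _ [F [_ XF] <-].
apply: (@le_trans _ _ (\sum_(k <oo) (box_content (F k `&` [set x | (x ord0 i <= c)%R]) +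
   box_content (F k `&` ~` [set x | (x ord0 i <= c)%R])))%E).
  rewrite nneseriesD//; try by move=> k _ _; exact: box_content_ge0.
  apply: leeD; apply: ereal_inf_lbound.
    exists (fun k => F k `&` [set x | x ord0 i <= c]) => //.
    split=> [k|x [/XF[k _ Fk] xc]]; first exact: sub_sigma_algebra.
    by exists k.
  exists (fun k => F k `&` ~` [set x | x ord0 i <= c]) => //.
  split=> [k|x [/XF[k _ Fk] xc]]; first exact: sub_sigma_algebra.
  by exists k.
apply: lee_nneseries => k _; last exact: box_content_split.
by move=> _; rewrite adde_ge0 ?box_content_ge0.
Qed.

(** An open set is a countable union of half-open cubes with rational centres, each of them a finite
    intersection of half-spaces and complements of half-spaces. *)
Lemma open_measurable_Leb A : open A -> measurable (A : set (Leb_space R n)).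
Proof.
move=> oA.
pose box (qm : 'rV[rat]_n * nat) : set 'rV[R]_n :=
  [set x | forall i, ratr (qm.1 ord0 i) - qm.2.+1%:R^-1 < x ord0 i
                     /\ x ord0 i <= ratr (qm.1 ord0 i) + qm.2.+1%:R^-1].
have mbox qm : measurable (box qm : set (Leb_space R n)).
  have -> : box qm = \bigcap_(i : 'I_n)
      (~` [set x : 'rV[R]_n | x ord0 i <= ratr (qm.1 ord0 i) - qm.2.+1%:R^-1] `&`
       [set x | x ord0 i <= ratr (qm.1 ord0 i) + qm.2.+1%:R^-1]).
    apply/seteqP; split=> x /= h i.
      by move=> _; have [h1 h2] := h i; split=> //=; apply/negP; rewrite -ltNge.
    by have [/negP] := h i I; rewrite -ltNge.
  apply: fin_bigcap_measurable => [|i _]; first exact: finite_finset.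
  apply: measurableI; last exact: measurable_halfspace.
  by apply: measurableC; exact: measurable_halfspace.
have -> : A = \bigcup_(qm in [set qm | box qm `<=` A]) box qm.
  apply/seteqP; split=> [x Ax|x [qm] /=]; last exact.
  have /open_dist/(_ _ Ax)[e e0 xe] := oA.
  (* Two points of a cube of half-width [h] differ by at most [2 h] in each coordinate, hence by at
     most [(n + 1) 2 h] in Euclidean distance. *)
  have [m me] : exists m : nat, m.+1%:R^-1 < e / (n.+1%:R * 2) :> R.
    have d0 : 0 < e / (n.+1%:R * 2) by rewrite divr_gt0// mulr_gt0.
    have [m _ /(_ _ (leqnn m)) mE] := near_infty_natSinv_lt (PosNum d0).
    by exists m.
  have [q xq] : {q : 'I_n -> rat & forall i, x ord0 i - m.+1%:R^-1 < ratr (q i) < x ord0 i + m.+1%:R^-1}.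
    apply: (@choice _ _ (fun i q => x ord0 i - m.+1%:R^-1 < ratr q < x ord0 i + m.+1%:R^-1)) => i.
    have m0 : 0 < m.+1%:R^-1 :> R by rewrite invr_gt0.
    have [|q] := @rat_in_itvoo R (x ord0 i - m.+1%:R^-1) (x ord0 i + m.+1%:R^-1); first by rewrite ltrD2l gtrN.
    by rewrite in_itv/=; exists q.
  exists (\row_i q i, m) => /=; last first.
    move=> i; rewrite /= mxE; have /andP[] := xq i; move: (m.+1%:R^-1 : R) => u; split; lra.
  move=> y /= qy; apply: xe; rewrite (le_lt_trans (enorm_le_norm _))//.
  suff h : `|x - y| <= m.+1%:R^-1 * 2.
    apply: (@le_lt_trans _ _ (n.+1%:R * (m.+1%:R^-1 * 2))); first by rewrite ler_wpM2l.
    move: me; rewrite ltr_pdivlMr ?mulr_gt0// => /(le_lt_trans _); apply.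
    by rewrite le_eqVlt; apply/orP; left; apply/eqP; ring.
  rewrite [leLHS]/Num.Def.normr/= mx_normrE; apply/bigmax_leP; split.
    by rewrite mulr_ge0// invr_ge0.
  move=> [i j] _ /=; rewrite ord1 !mxE; have := qy j; rewrite /= !mxE => -[].
  have /andP[] := xq j; move: (m.+1%:R^-1 : R) => u ? ? ? ?; rewrite ler_norml; apply/andP; split; lra.
rewrite bigcup_mkcond; apply: countable_bigcupT_measurable; first exact: countableP.
by move=> qm; case: ifP.
Qed.

End LebOuter.

(** * Lipschitz envelopes *)

Section Envelope.
Variables (R : realType) (n : nat).
Notation pt := 'rV[R]_n.
Implicit Types (E X : set pt) (g f phi : pt -> R) (x y z : pt) (k M : R).

(** The index type is arbitrary because the lemma serves twice: for inf-convolutions, and for the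
    scale [t] built in [wide_scale]. *)
Lemma inf_lip (T : Type) (I : set T) (F : T -> pt -> R) k c :
  I !=set0 -> (forall i x, I i -> c <= F i x) ->
  (forall i x y, I i -> F i x <= F i y + k * dist x y) ->
  forall x y, `|inf [set F i x | i in I] - inf [set F i y | i in I]| <= k * dist x y.
Proof.
move=> [i0 Ii0] cF FL.
have lb x : has_lbound [set F i x | i in I].
  by exists c => _ [i Ii <-]; exact: cF.
suff H x y : inf [set F i x | i in I] <= inf [set F i y | i in I] + k * dist x y.
  move=> x y; have := H x y; have := H y x; rewrite (distC y x) ler_norml => ? ?.
  by apply/andP; split; lra.
rewrite -lerBlDr; apply: lb_le_inf; first by exists (F i0 y); exists i0.
move=> _ [i Ii <-]; rewrite lerBlDr (le_trans _ (FL _ x y Ii))//.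
by apply: ge_inf => //; exists i.
Qed.

(** The Pasch-Hausdorff (McShane) envelope. The set [E] varies: continuity points for a function of
    [Cae], all of [X] for the continuous approximant, the whole space for [dX]. *)
Definition env E g k x : R := inf [set g z + k * dist x z | z in E].

Definition dense_in X E := forall x (e : R), X x -> 0 < e -> exists2 z, E z & dist x z < e.

Section env_lemmas.
Variables (E : set pt) (g : pt -> R) (k M : R).
Hypotheses (E0 : E !=set0) (gM : forall z, E z -> - M <= g z) (k0 : 0 <= k).

Lemma env_le x z : E z -> env E g k x <= g z + k * dist x z.
Proof.
move=> Ez; apply: ge_inf; last by exists z.
by exists (- M) => _ [y Ey <-]; rewrite -[leLHS]addr0 lerD ?gM// mulr_ge0// dist_ge0.
Qed.

Lemma env_ge x c : (forall z, E z -> c <= g z + k * dist x z) -> c <= env E g k x.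
Proof.
move=> h; apply: lb_le_inf => [|_ [z Ez <-]]; last exact: h.
by case: E0 => z Ez; exists (g z + k * dist x z); exists z.
Qed.

Lemma env_near x (e : R) : 0 < e -> exists2 z, E z & g z + k * dist x z < env E g k x + e.
Proof.
move=> e0; apply: contrapT => /forall2NP h.
suff : env E g k x + e <= env E g k x by lra.
apply: env_ge => z Ez; have [//|/negP] := h z.
by rewrite -leNgt.
Qed.

Lemma env_lip x y : `|env E g k x - env E g k y| <= k * dist x y.
Proof.
apply: (@inf_lip _ E (fun z x => g z + k * dist x z) k (- M)) => // [z w Ez|z u v Ez].
  by rewrite -[leLHS]addr0 lerD ?gM// mulr_ge0// dist_ge0.
by rewrite -addrA lerD2l -mulrDr ler_wpM2l// addrC dist_tri.
Qed.

Lemma env_geN x : - M <= env E g k x.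
Proof.
by apply: env_ge => z Ez; rewrite -[leLHS]addr0 lerD ?gM// mulr_ge0// dist_ge0.
Qed.

Lemma env_leM X x : dense_in X E -> X x -> (forall z, E z -> g z <= M) ->
  env E g k x <= M.
Proof.
move=> XE Xx gM'; apply/ler_addgt0Pr => e e0.
have k1 : 0 < e / (k + 1) by rewrite divr_gt0// ltr_wpDl.
have [z Ez xz] := XE x _ Xx k1.
apply: le_trans (env_le x Ez) _; rewrite lerD ?gM'//.
rewrite ltr_pdivlMr ?ltr_wpDl// in xz.
by have := dist_ge0 x z; nra.
Qed.

Lemma env_le_self z : E z -> env E g k z <= g z.
Proof. by move=> Ez; rewrite (le_trans (env_le z Ez))// distxx mulr0 addr0. Qed.

End env_lemmas.

Definition cpt X f := [set x | X x /\ {for x, continuous f}].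

Lemma continuous_opp f x : {for x, continuous f} -> {for x, continuous (fun x => - f x)}.
Proof.
move=> /continuous_dist h; apply/continuous_dist => e /h[d d0 fd].
by exists d => // y /fd; rewrite -opprD normrN.
Qed.

Lemma cptN X f : cpt X (fun x => - f x) = cpt X f.
Proof.
apply/seteqP; split=> x [Xx fx]; split=> //; last exact: continuous_opp.
have -> : f = (fun x => - - f x) by apply/funext => y; rewrite opprK.
exact: continuous_opp.
Qed.

Lemma CaeN X f : Cae X f -> Cae X (fun x => - f x).
Proof.
move=> [[M fM] f0]; split; first by exists M => x /fM; rewrite normrN.
rewrite -[RHS]f0; congr leb_outer; apply/seteqP; split=> x [Xx h]; split=> // fx;
  apply: h; first exact: continuous_opp.
have : cpt X (fun x => - f x) x by [].
by rewrite cptN => -[].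
Qed.

(** * Envelopes of functions in [Cae] *)

Section lower_env.
Variables (X : set pt) (oX : open X) (X0 : X !=set0).

Lemma null_ball A x (e : R) : 0 < e -> leb_outer A = 0%E -> exists2 y : pt, dist x y < e & ~ A y.
Proof.
move=> e0 A0; apply: contrapT => /forall2NP h.
have := @leb_outer_ball_gt0 R n x e e0; rewrite ltNge => /negP; apply.
rewrite -A0; apply: le_outer_measure => y /= xy.
by have [//|/contrapT] := h y.
Qed.

Lemma cpt_dense f : Cae X f -> dense_in X (cpt X f).
Proof.
move=> [_ f0] x e Xx e0; have /open_dist/(_ _ Xx)[d d0 xd] := oX.
have m0 : 0 < Num.min e d by rewrite lt_min e0.
have [y] := null_ball x m0 f0; rewrite lt_min => /andP[xe /xd Xy] ny.
by exists y => //; split=> //; apply: contrapT => ?; apply: ny.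
Qed.

Lemma cpt_neq0 f : Cae X f -> cpt X f !=set0.
Proof.
by move=> cf; case: X0 => x Xx; have [z zf _] := cpt_dense cf Xx ltr01; exists z.
Qed.

Lemma LipOn_cont k phi x : LipOn X k phi -> X x -> {for x, continuous phi}.
Proof.
move=> phiL Xx; have /open_dist/(_ _ Xx)[d d0 xd] := oX.
apply/continuous_dist => e e0.
have k1 : 0 < `|k| + 1 by rewrite ltr_wpDl.
exists (Num.min d (e / (`|k| + 1))); first by rewrite lt_min d0 divr_gt0.
move=> y; rewrite lt_min => /andP[/xd Xy]; rewrite ltr_pdivlMr// => xy.
apply: le_lt_trans (phiL _ _ Xx Xy) _.
by have := dist_ge0 x y; have := ler_norm k; nra.
Qed.

(** A strict inequality the other way at [z] would persist on a ball by continuity, and balls are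
    not null. This turns almost-everywhere bounds into pointwise bounds on [cpt X f]. *)
Lemma ale_on_cpt f phi z : ale_on X phi f -> {for z, continuous phi} -> cpt X f z -> phi z <= f z.
Proof.
move=> h0 phiz [Xz fz]; rewrite leNgt; apply/negP => fphi.
pose e := (phi z - f z) / 2; have e0 : 0 < e by rewrite divr_gt0// subr_gt0.
have /continuous_dist/(_ _ e0)[d1 d10 h1] := fz.
have /continuous_dist/(_ _ e0)[d2 d20 h2] := phiz.
have /open_dist/(_ _ Xz)[d d0 xd] := oX.
have m0 : 0 < Num.min d (Num.min d1 d2) by rewrite !lt_min d0 d10.
have [y] := null_ball z m0 h0.
rewrite !lt_min => /and3P[/xd Xy /h1 h3 /h2 h4]; apply; split=> //.
move: h3 h4; rewrite !ltr_norml /e => /andP[? ?] /andP[? ?]; lra.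
Qed.

(** A competitor [phi] is below [f] on [cpt X f], so its Lipschitz bound puts it below the
    inf-convolution. Conversely the inf-convolution is itself a competitor, being below [f] off a
    null set. *)
Lemma lower_envE f (k : nat) x : Cae X f -> X x ->
  lower_env X k f x = env (cpt X f) f k%:R x.
Proof.
move=> cf Xx; have [[M fM] f0] := cf; have D0 := cpt_neq0 cf.
have fM' z : cpt X f z -> - M <= f z by move=> [/fM]; rewrite ler_norml => /andP[].
have ub phi : LipOn X k%:R phi -> ale_on X phi f -> phi x <= env (cpt X f) f k%:R x.
  move=> phiL phif; apply: env_ge => // z zD.
  have := ale_on_cpt phif (LipOn_cont phiL zD.1) zD.
  by have := phiL x z Xx zD.1; rewrite ler_norml => /andP[? ?]; lra.
apply/eqP; rewrite eq_le; apply/andP; split.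
  apply: ge_sup => [|_ [phi [phiL phif] <-]]; last exact: ub.
  exists (- M); exists (fun=> - M) => //; split.
    by move=> u v Xu Xv; rewrite subrr normr0 mulr_ge0// dist_ge0.
  rewrite /ale_on (_ : [set _ | _] = set0) ?outer_measure0//.
  apply/seteqP; split=> // u [/fM + /=]; rewrite ler_norml => /andP[? _]; lra.
apply: ub_le_sup.
  by exists (env (cpt X f) f k%:R x) => _ [phi [phiL phif] <-]; exact: ub.
exists (env (cpt X f) f k%:R) => //; split; first by move=> u v _ _; exact: (@env_lip _ _ _ M).
apply/eqP; rewrite eq_le outer_measure_ge0 andbT -f0; apply: le_outer_measure.
move=> z [Xz]; rewrite ltNge => /negP h; split=> // fz; apply: h.
by apply: (@env_le_self _ _ _ M).
Qed.

Lemma upper_envN (f : pt -> R) (k : nat) x :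
  upper_env X k f x = - lower_env X k (fun x => - f x) x.
Proof.
rewrite /upper_env /lower_env /inf; congr (- sup _); apply/seteqP; split.
  move=> _ [_ [phi [phiL phif] <-] <-]; exists (fun x => - phi x) => //; split.
    by move=> u v Xu Xv; rewrite -opprD normrN; exact: phiL.
  rewrite /ale_on -[RHS]phif; congr leb_outer; apply/seteqP.
  by split=> u [Xu] /=; rewrite ltrN2.
move=> _ [phi [phiL phif] <-]; exists (- phi x); last by rewrite opprK.
exists (fun x => - phi x) => //; split.
  by move=> u v Xu Xv; rewrite -opprD normrN; exact: phiL.
rewrite /ale_on -[RHS]phif; congr leb_outer; apply/seteqP.
by split=> u [Xu] /=; rewrite ltrNl.
Qed.

Lemma lower_env_lip f (k : nat) : Cae X f -> LipOn X k%:R (lower_env X k f).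
Proof.
move=> cf x y Xx Xy; rewrite !lower_envE//; have [[M fM] _] := cf.
apply: (@env_lip _ _ _ M) => //; first exact: cpt_neq0.
by move=> z [/fM]; rewrite ler_norml => /andP[].
Qed.

Lemma upper_env_lip f (k : nat) : Cae X f -> LipOn X k%:R (upper_env X k f).
Proof.
move=> cf x y Xx Xy; rewrite !upper_envN -opprD normrN.
exact: (lower_env_lip k (CaeN cf)).
Qed.

Lemma lower_env_le f (k : nat) z : Cae X f -> cpt X f z -> lower_env X k f z <= f z.
Proof.
move=> cf Dz; rewrite lower_envE//; last by case: Dz.
have [[M fM] _] := cf.
by apply: (@env_le_self _ _ _ M) => // u [/fM]; rewrite ler_norml => /andP[].
Qed.

Lemma upper_env_ge f (k : nat) z : Cae X f -> cpt X f z -> f z <= upper_env X k f z.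
Proof.
move=> cf Dz; rewrite upper_envN lerNr; apply: (lower_env_le k (CaeN cf)).
by rewrite cptN.
Qed.

(** The maximality of the lower envelope, with the almost-everywhere comparison replaced by a
    pointwise one on [cpt X f]. *)
Lemma le_lower_env f (k : nat) phi x : Cae X f -> LipOn X k%:R phi ->
  (forall z, cpt X f z -> phi z <= f z) -> X x -> phi x <= lower_env X k f x.
Proof.
move=> cf phiL phif Xx; rewrite lower_envE//; apply: env_ge; first exact: cpt_neq0.
move=> z Dz; have := phiL x z Xx Dz.1; have := phif z Dz.
by rewrite ler_norml => ? /andP[? ?]; lra.
Qed.

Lemma lower_env_bound f M (k : nat) x : Cae X f -> (forall x, X x -> `|f x| <= M) ->
  X x -> `|lower_env X k f x| <= M.
Proof.
move=> cf fM Xx; rewrite lower_envE//.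
have D0 := cpt_neq0 cf.
have fM' z : cpt X f z -> - M <= f z <= M by move=> [/fM]; rewrite ler_norml.
rewrite ler_norml; apply/andP; split.
  by apply: env_geN => // z /fM'/andP[].
apply: env_leM (cpt_dense cf) Xx _ => // z /fM'/andP[]//.
Qed.

Lemma upper_env_bound f M (k : nat) x : Cae X f -> (forall x, X x -> `|f x| <= M) ->
  X x -> `|upper_env X k f x| <= M.
Proof.
move=> cf fM Xx; rewrite upper_envN normrN.
by apply: (lower_env_bound k (CaeN cf)) => // y /fM; rewrite normrN.
Qed.

Lemma LipOn_le k k' phi : k <= k' -> LipOn X k phi -> LipOn X k' phi.
Proof.
move=> kk' phiL x y Xx Xy; apply: le_trans (phiL _ _ Xx Xy) _.
by rewrite ler_wpM2r// dist_ge0.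
Qed.

Lemma lower_env_mono f (k j : nat) x : Cae X f -> (k <= j)%N -> X x ->
  lower_env X k f x <= lower_env X j f x.
Proof.
move=> cf kj Xx; apply: le_lower_env => // [|z]; last exact: lower_env_le.
by apply: LipOn_le (lower_env_lip k cf); rewrite ler_nat.
Qed.

Lemma upper_env_mono f (k j : nat) x : Cae X f -> (k <= j)%N -> X x ->
  upper_env X j f x <= upper_env X k f x.
Proof.
by move=> cf kj Xx; rewrite !upper_envN lerN2; exact: (lower_env_mono (CaeN cf)).
Qed.

Lemma dense_le f phi psi x : dense_in X (cpt X f) ->
  {for x, continuous phi} -> {for x, continuous psi} ->
  (forall z, cpt X f z -> phi z <= psi z) -> X x -> phi x <= psi x.
Proof.
move=> dD phix psix h Xx; apply/ler_addgt0Pr => e e0.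
have e2 : 0 < e / 2 by rewrite divr_gt0.
have /continuous_dist/(_ _ e2)[d1 d10 h1] := phix.
have /continuous_dist/(_ _ e2)[d2 d20 h2] := psix.
have m0 : 0 < Num.min d1 d2 by rewrite !lt_min d10.
have [z Dz] := dD _ _ Xx m0; rewrite lt_min => /andP[/h1 + /h2].
by have := h _ Dz; rewrite !ltr_norml => ? /andP[? ?] /andP[? ?]; lra.
Qed.

Lemma lower_le_upper f (k j : nat) x : Cae X f -> X x ->
  lower_env X k f x <= upper_env X j f x.
Proof.
move=> cf Xx; apply: (dense_le (cpt_dense cf)) => //.
- exact: LipOn_cont (lower_env_lip k cf) Xx.
- exact: LipOn_cont (upper_env_lip j cf) Xx.
- by move=> z Dz; rewrite (le_trans (lower_env_le k cf Dz))// upper_env_ge.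
Qed.

(** Points close to [z] have values above [f z - e] by continuity; for the points at distance at
    least [d], the penalty [k d] outweighs the oscillation [2 M] of [f] once [k] is large. *)
Lemma lower_env_cvg f z (e : R) : Cae X f -> cpt X f z -> 0 < e ->
  exists K : nat, forall k : nat, (K <= k)%N -> f z - e <= lower_env X k f z.
Proof.
move=> cf Dz e0; have [[M fM] _] := cf; have [Xz fz] := Dz.
have /continuous_dist/(_ _ e0)[d d0 h] := fz.
have M0 : 0 <= M by apply: le_trans (fM _ Xz).
pose K := (Num.truncn (2 * M / d)).+1; exists K => k Kk.
rewrite lower_envE//; apply: env_ge; first exact: cpt_neq0.
move=> y Dy; have [/h|dy] := ltP (dist z y) d.
  rewrite ltr_norml => /andP[? ?].
  have : 0 <= k%:R * dist z y by rewrite mulr_ge0// dist_ge0.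
  lra.
have kd : 2 * M <= k%:R * d.
  rewrite -ler_pdivrMr// (le_trans (ltW (truncnS_gt _)))//.
  by rewrite ler_nat.
have : k%:R * d <= k%:R * dist z y by rewrite ler_wpM2l.
have := fM _ Xz; have := fM _ Dy.1; rewrite !ler_norml => /andP[? ?] /andP[? ?]; lra.
Qed.

Lemma upper_env_cvg f z (e : R) : Cae X f -> cpt X f z -> 0 < e ->
  exists K : nat, forall k : nat, (K <= k)%N -> upper_env X k f z <= f z + e.
Proof.
move=> cf Dz e0; have Dz' : cpt X (fun x => - f x) z by rewrite cptN.
have [K h] := lower_env_cvg (CaeN cf) Dz' e0; exists K => k /h.
by rewrite upper_envN; lra.
Qed.

End lower_env.
End Envelope.

(** * Integrals over X *)

Section Integral.
Variables (R : realType) (n : nat).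
Notation pt := 'rV[R]_n.
Variables (X : set pt) (oX : open X) (X0 : X !=set0) (bX : bounded_set X).
Implicit Types (f g h phi psi chi : pt -> R).

Definition contX f := forall x, X x -> {for x, continuous f}.

Definition intX h : \bar R := (\int[@Leb R n]_(x in (X : set (Leb_space R n))) (h x)%:E)%E.

Lemma open_superlevel h (a : R) : contX h -> open [set x | X x /\ a < h x].
Proof.
move=> ch; apply/open_dist => x [Xx ax].
have /open_dist/(_ _ Xx)[d d0 xd] := oX.
have e0 : 0 < h x - a by rewrite subr_gt0.
have /continuous_dist/(_ _ e0)[d' d'0 xd'] := ch _ Xx.
exists (Num.min d d'); first by rewrite lt_min d0.
move=> y; rewrite lt_min => /andP[/xd Xy /xd']; rewrite ltr_norml => /andP[? ?].
by split=> //; lra.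
Qed.

Lemma contX_measurable h : contX h ->
  measurable_fun (X : set (Leb_space R n)) (EFin \o h).
Proof.
move=> ch; apply/measurable_EFinP.
apply: (measurability _ (RGenOInfty.measurableE R)) => _ [_ [a ->] <-].
apply: open_measurable_Leb; rewrite (_ : _ `&` _ = [set x | X x /\ a < h x]).
  exact: open_superlevel.
by apply/seteqP; split=> x /= [Xx]; rewrite in_itv/= andbT.
Qed.

Lemma measurable_X : measurable (X : set (Leb_space R n)).
Proof. exact: open_measurable_Leb. Qed.

Lemma contXN f : contX f -> contX (fun x => - f x).
Proof. by move=> cf x Xx; apply: continuous_opp; exact: cf. Qed.

Lemma contXD f g : contX f -> contX g -> contX (fun x => f x + g x).
Proof.
move=> cf cg x Xx; apply/continuous_dist => e e0.
have e2 : 0 < e / 2 by rewrite divr_gt0.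
have /continuous_dist/(_ _ e2)[d d0 xd] := cf _ Xx.
have /continuous_dist/(_ _ e2)[d' d'0 xd'] := cg _ Xx.
exists (Num.min d d'); first by rewrite lt_min d0.
move=> y; rewrite lt_min => /andP[/xd + /xd'].
by rewrite !ltr_norml => /andP[? ?] /andP[? ?]; apply/andP; split; lra.
Qed.

Lemma contXB f g : contX f -> contX g -> contX (fun x => f x - g x).
Proof. by move=> cf cg; apply: contXD => //; exact: contXN. Qed.

Lemma contX_norm f : contX f -> contX (fun x => `|f x|).
Proof.
move=> cf x Xx; apply/continuous_dist => e e0.
have /continuous_dist/(_ _ e0)[d d0 xd] := cf _ Xx.
by exists d => // y /xd; apply: le_lt_trans; exact: ler_dist_dist.
Qed.

Lemma contX_LipOn (k : R) f : LipOn X k f -> contX f.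
Proof. by move=> fL x Xx; exact: LipOn_cont fL Xx. Qed.

Lemma contX_cst (c : R) : contX (fun=> c).
Proof. by move=> x Xx; apply/continuous_dist => e e0; exists 1 => // y _; rewrite subrr normr0. Qed.

Lemma intX_ge0 h : (forall x, X x -> 0 <= h x) -> (0 <= intX h)%E.
Proof. by move=> h0; apply: integral_ge0 => x Xx; rewrite lee_fin; exact: h0. Qed.

Lemma intX_le g h : contX g -> contX h -> (forall x, X x -> 0 <= g x <= h x) ->
  (intX g <= intX h)%E.
Proof.
move=> cg ch gh; apply: ge0_le_integral.
- exact: measurable_X.
- by move=> x Xx; rewrite lee_fin; have /andP[] := gh x Xx.
- exact: contX_measurable.
- exact: contX_measurable.
- by move=> x Xx; rewrite lee_fin; have /andP[] := gh x Xx.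
Qed.

Lemma intXD g h : contX g -> contX h -> (forall x, X x -> 0 <= g x) ->
  (forall x, X x -> 0 <= h x) -> intX (fun x => g x + h x) = (intX g + intX h)%E.
Proof.
move=> cg ch g0 h0.
exact: (@ge0_integralD _ _ _ (@Leb R n) X measurable_X (EFin \o g) (EFin \o h)
  g0 (contX_measurable cg) h0 (contX_measurable ch)).
Qed.

Definition volX : R := fine (@leb_outer R n X).

Lemma volXE : @leb_outer R n X = volX%:E.
Proof. by rewrite fineK// ge0_fin_numE ?outer_measure_ge0// leb_outer_bounded. Qed.

Lemma volX_ge0 : 0 <= volX.
Proof. by rewrite fine_ge0// outer_measure_ge0. Qed.

Lemma intX_cst (c : R) : intX (fun=> c) = (c * volX)%:E.
Proof.
rewrite /intX (integral_cst (@Leb R n) measurable_X) EFinM -volXE; congr (_ * _)%E.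
Qed.

Lemma intX_le_cst h (c : R) : contX h -> (forall x, X x -> 0 <= h x <= c) ->
  (intX h <= (c * volX)%:E)%E.
Proof. by move=> ch hc; rewrite -intX_cst; apply: intX_le => //; exact: contX_cst. Qed.

(** Markov's inequality. *)
Lemma superlevel_null h (d : R) : contX h -> (forall x, X x -> 0 <= h x) -> 0 < d ->
  (d%:E * @leb_outer R n [set x | X x /\ (d < h x)%R] <= intX h)%E.
Proof.
move=> ch h0 d0; pose A : set (Leb_space R n) := [set x | X x /\ d < h x].
have mA : measurable A by apply: open_measurable_Leb; exact: open_superlevel.
have AX : A `<=` X by move=> x [].
apply: (@le_trans _ _ (\int[@Leb R n]_(x in A) (h x)%:E)%E); last first.
  exact: (ge0_subset_integral (@Leb R n) mA measurable_X (contX_measurable ch) h0 AX).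
rewrite -(integral_cst (@Leb R n) mA); apply: ge0_le_integral.
- exact: mA.
- by move=> x _; rewrite lee_fin ltW.
- exact: measurable_cst.
- apply: measurable_funS AX (contX_measurable ch); exact: measurable_X.
- by move=> x [_ /ltW]; rewrite lee_fin.
Qed.

Lemma null_measurable (A : set pt) : leb_outer A = 0%E ->
  measurable (A : set (Leb_space R n)).
Proof.
move=> A0; apply: le_caratheodory_measurable => B.
rewrite (_ : _ (B `&` A) = 0%E); last first.
  by apply/eqP; rewrite eq_le outer_measure_ge0 andbT -A0; exact: le_outer_measure.
by rewrite add0e; exact: le_outer_measure.
Qed.

(** Dominated convergence: the gap tends to 0 at every continuity point, hence almost everywhere,
    and is bounded by [2 M] on a set of finite measure. *)
Lemma env_gap_intX f (e : R) : Cae X f -> 0 < e -> exists K : nat,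
  forall k, (K <= k)%N ->
  (intX (fun x => upper_env X k f x - lower_env X k f x)%R <= e%:E)%E.
Proof.
move=> cf e0; have [[M fM] f0] := cf.
pose F k x := upper_env X k f x - lower_env X k f x.
have cF k : contX (F k).
  apply: contXB; first exact: contX_LipOn (upper_env_lip oX X0 k cf).
  exact: contX_LipOn (lower_env_lip oX X0 k cf).
have F0 k x : X x -> 0 <= F k x.
  by move=> Xx; rewrite subr_ge0; exact: lower_le_upper.
have [] := @dominated_convergence _ _ R (@Leb R n) X measurable_X
  (fun k => EFin \o F k) (cst 0%E) (cst (2 * M)%:E).
- by move=> k; exact: contX_measurable.
- exact: measurable_cst.
- exists [set x | X x /\ ~ {for x, continuous f}]; split=> //.
    exact: null_measurable.
  move=> x /= /not_implyP[Xx nF]; split=> // fx; apply: nF.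
  apply: cvg_EFin; first exact: nearW.
  apply/cvgrPdist_le => d d0; have d2 : 0 < d / 2 by rewrite divr_gt0.
  have Dx : cpt X f x by [].
  have [K1 h1] := lower_env_cvg oX X0 cf Dx d2.
  have [K2 h2] := upper_env_cvg oX X0 cf Dx d2.
  near=> k.
  have /h1 a1 : (K1 <= k)%N by near: k; exact: nbhs_infty_ge.
  have /h2 a2 : (K2 <= k)%N by near: k; exact: nbhs_infty_ge.
  rewrite /= sub0r normrN ger0_norm ?F0// /F; lra.
- apply/integrableP; split; first exact: measurable_cst.
  rewrite /= integral_cst; last exact: measurable_X.
  by rewrite [X in (_ * X)%E](_ : _ = volX%:E) -?EFinM ?ltry//; exact: volXE.
- apply/aeW => x k Xx /=; rewrite lee_fin ger0_norm ?F0// /F.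
  have := lower_env_bound oX X0 k cf fM Xx; have := upper_env_bound oX X0 k cf fM Xx.
  by rewrite !ler_norml => /andP[? ?] /andP[? ?]; lra.
move=> _ + _; move=> /fine_cvgP[hfin /cvgrPdist_le/(_ _ e0) hc].
have [K _ hK] : \forall k \near \oo, (intX (F k) <= e%:E)%E.
  near=> k.
  have kfin : (\int[@Leb R n]_(x in X) `|(F k x)%:E - 0%E|)%E \is a fin_num.
    by near: k; exact: hfin.
  have kc : `|0 - fine (\int[@Leb R n]_(x in X) `|(F k x)%:E - 0%E|)%E| <= e.
    by near: k; exact: hc.
  have E : intX (F k) = (\int[@Leb R n]_(x in X) `|(F k x)%:E - 0%E|)%E.
    apply: eq_integral => x /set_mem Xx; rewrite sube0/= ger0_norm//.
    exact: F0.
  rewrite E -(fineK kfin) lee_fin; move: kc; rewrite sub0r normrN.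
  exact: le_trans (ler_norm _).
by exists K.
Unshelve. all: by end_near. Qed.

End Integral.

(** * The distances h, delta and r *)

Section Distances.
Variables (R : realType) (n : nat).
Notation pt := 'rV[R]_n.
Variables (X : set pt) (oX : open X) (X0 : X !=set0) (bX : bounded_set X).
Implicit Types (f g h phi psi chi : pt -> R).

(** One half of a Hausdorff bound, stated on the graphs themselves: passing to closures does not
    change the distance, and points over [X] are easier to handle. *)
Definition graph_near (e : R) phi psi := forall x, X x ->
  exists2 y, X y & edist1 (x, phi x) (y, psi y) < e.

Lemma graph_near_tri (a b : R) phi psi chi :
  graph_near a phi psi -> graph_near b psi chi -> graph_near (a + b) phi chi.
Proof.
move=> h1 h2 x /h1[y /h2[z Xz yz] xy]; exists z => //.
by rewrite (le_lt_trans (edist1_tri (y, psi y) _ _))// ltrD.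
Qed.

Lemma graph_near_sup (c e : R) phi psi : (forall x, X x -> `|phi x - psi x| <= c) ->
  c < e -> graph_near e phi psi.
Proof.
move=> h ce x Xx; exists x => //; apply: le_lt_trans ce.
by rewrite (le_trans (edist1_le _ _))//= distxx add0r h.
Qed.

Definition dsup (A B : set (pt * R)) : \bar R :=
  ereal_sup [set ereal_inf [set (edist1 p q)%:E | q in B] | p in A].

Lemma dsup_ge0 A B : A !=set0 -> (0 <= dsup A B)%E.
Proof.
move=> [p Ap]; apply: le_ereal_sup_tmp.
exists (ereal_inf [set (edist1 p q)%:E | q in B]); first by exists p.
by apply: le_ereal_inf_tmp => _ [q _ <-]; rewrite lee_fin edist1_ge0.
Qed.

Lemma graph_in_closure phi x : X x -> closure (graph_on X phi) (x, phi x).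
Proof. by move=> Xx; apply: subset_closure; exists x. Qed.

Lemma dsup_lt (e : R) phi psi :
  (dsup (closure (graph_on X phi)) (closure (graph_on X psi)) < e%:E)%E ->
  graph_near e phi psi.
Proof.
move=> h x Xx.
have : (ereal_inf [set (edist1 (x, phi x) q)%:E | q in closure (graph_on X psi)] < e%:E)%E.
  apply: le_lt_trans h; apply: ereal_sup_ubound; exists (x, phi x) => //.
  exact: graph_in_closure.
move=> /ereal_inf_lt[_ [q /closure_edist1 cq <-]]; rewrite lte_fin -subr_gt0 => qe.
have [_ [y Xy <-] qy] := cq _ qe; exists y => //.
by rewrite (le_lt_trans (edist1_tri q _ _))// addrC -ltrBrDr.
Qed.

Lemma dsup_le (e : R) phi psi : graph_near e phi psi ->
  (dsup (closure (graph_on X phi)) (closure (graph_on X psi)) <= e%:E)%E.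
Proof.
move=> h; apply: ge_ereal_sup => _ [p /closure_edist1 cp <-].
apply/lee_addgt0Pr => d d0; have [_ [x Xx <-] px] := cp _ d0.
have [y Xy xy] := h _ Xx.
apply: (@ge_ereal_inf _ _ _); exists (edist1 p (y, psi y))%:E.
  by exists (y, psi y) => //; exact: graph_in_closure.
rewrite -EFinD lee_fin (le_trans (edist1_tri (x, phi x) _ _))// addrC.
by rewrite lerD// ltW.
Qed.

Lemma hdistE phi psi : hdist X phi psi =
  Order.max (dsup (closure (graph_on X phi)) (closure (graph_on X psi)))
            (dsup (closure (graph_on X psi)) (closure (graph_on X phi))).
Proof. by []. Qed.

Lemma hdist_lt (e : R) phi psi : (hdist X phi psi < e%:E)%E ->
  graph_near e phi psi /\ graph_near e psi phi.
Proof. by rewrite hdistE gt_max => /andP[/dsup_lt ? /dsup_lt]. Qed.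

Lemma hdist_le (e : R) phi psi : graph_near e phi psi -> graph_near e psi phi ->
  (hdist X phi psi <= e%:E)%E.
Proof. by move=> h1 h2; rewrite hdistE ge_max !dsup_le. Qed.

Lemma hdist_ge0 phi psi : (0 <= hdist X phi psi)%E.
Proof.
rewrite hdistE le_max dsup_ge0//; case: X0 => x Xx.
by exists (x, phi x); exact: graph_in_closure.
Qed.

Lemma hdistC phi psi : hdist X phi psi = hdist X psi phi.
Proof. by rewrite !hdistE maxC. Qed.

Lemma hdist_tri psi phi chi : (hdist X phi chi <= hdist X phi psi + hdist X psi chi)%E.
Proof.
have := hdist_ge0 phi psi; have := hdist_ge0 psi chi.
case Ea : (hdist X phi psi) => [a| |]//; last first.
  by move=> h _; rewrite addye ?leey// gt_eqF// (lt_le_trans _ h)// ltNy0.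
case Eb : (hdist X psi chi) => [b| |]//; last by move=> _ _; rewrite leey.
move=> _ _.
apply/lee_addgt0Pr => d d0; have d2 : 0 < d / 2 by rewrite divr_gt0.
have [h1 h1'] : graph_near (a + d / 2) phi psi /\ graph_near (a + d / 2) psi phi.
  by apply: hdist_lt; rewrite Ea lte_fin ltrDl.
have [h2 h2'] : graph_near (b + d / 2) psi chi /\ graph_near (b + d / 2) chi psi.
  by apply: hdist_lt; rewrite Eb lte_fin ltrDl.
rewrite -!EFinD (_ : a + b + d = (a + d / 2) + (b + d / 2)); last by field.
apply: hdist_le; first exact: graph_near_tri h1 h2.
by rewrite addrC; exact: graph_near_tri h2' h1'.
Qed.

Lemma hdist_sup (c : R) phi psi : (forall x, X x -> `|phi x - psi x| <= c) ->
  (hdist X phi psi <= c%:E)%E.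
Proof.
move=> h; apply/lee_addgt0Pr => d d0; rewrite -EFinD; apply: hdist_le.
  by apply: graph_near_sup h _; rewrite ltrDl.
apply: (@graph_near_sup c); last by rewrite ltrDl.
by move=> x Xx; rewrite distrC h.
Qed.

(** The partner of [x] costs [e] in value, and returning to [x] along [psi] costs [k * e]. For a
    fixed slope, Hausdorff closeness is thus uniform closeness. *)
Lemma graph_near_LipOn (e k : R) phi psi x : graph_near e phi psi -> 0 <= k ->
  LipOn X k psi -> X x -> `|phi x - psi x| <= (1 + k) * e.
Proof.
move=> h k0 psiL Xx; have [y Xy xy] := h _ Xx.
have h1 := le_lt_trans (dist_le_edist1 _ _) xy.
have h2 := le_lt_trans (gap_le_edist1 _ _) xy.
have h3 := psiL _ _ Xy Xx; rewrite distC /= in h1 h2 h3.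
rewrite (le_trans (ler_distD (psi y) _ _))// mulrDl mul1r lerD//; first exact: ltW.
by apply: le_trans h3 _; rewrite ler_wpM2l// ltW.
Qed.

Definition L1dist phi psi : \bar R := intX X (fun x => `|phi x - psi x|).

Lemma delta_distE phi psi : delta_dist X phi psi = (hdist X phi psi + L1dist phi psi)%E.
Proof. by []. Qed.

Lemma L1dist_ge0 phi psi : (0 <= L1dist phi psi)%E.
Proof. exact: intX_ge0. Qed.

Lemma L1distC phi psi : L1dist phi psi = L1dist psi phi.
Proof. by congr intX; apply/funext => x; rewrite distrC. Qed.

Lemma contX_absB phi psi : contX X phi -> contX X psi -> contX X (fun x => `|phi x - psi x|).
Proof. by move=> cf cg; apply: contX_norm; exact: contXB. Qed.

Lemma L1dist_tri psi phi chi : contX X phi -> contX X psi -> contX X chi ->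
  (L1dist phi chi <= L1dist phi psi + L1dist psi chi)%E.
Proof.
move=> c1 c2 c3; rewrite /L1dist -intXD//; try exact: contX_absB.
apply: intX_le => //; first exact: contX_absB.
  by apply: contXD; exact: contX_absB.
by move=> x Xx; rewrite normr_ge0/= ler_distD.
Qed.

Lemma L1dist_sup (c : R) phi psi : contX X phi -> contX X psi ->
  (forall x, X x -> `|phi x - psi x| <= c) -> (L1dist phi psi <= (c * volX X)%:E)%E.
Proof.
move=> c1 c2 h; apply: intX_le_cst => //; first exact: contX_absB.
by move=> x Xx; rewrite normr_ge0 h.
Qed.

Lemma delta_ge0 phi psi : (0 <= delta_dist X phi psi)%E.
Proof. by rewrite delta_distE adde_ge0 ?hdist_ge0 ?L1dist_ge0. Qed.

Lemma deltaC phi psi : delta_dist X phi psi = delta_dist X psi phi.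
Proof. by rewrite !delta_distE hdistC L1distC. Qed.

Lemma delta_tri psi phi chi : contX X phi -> contX X psi -> contX X chi ->
  (delta_dist X phi chi <= delta_dist X phi psi + delta_dist X psi chi)%E.
Proof.
move=> c1 c2 c3; rewrite !delta_distE addeACA.
by rewrite leeD ?hdist_tri ?L1dist_tri.
Qed.

Lemma delta_sup (c : R) phi psi : contX X phi -> contX X psi ->
  (forall x, X x -> `|phi x - psi x| <= c) ->
  (delta_dist X phi psi <= (c * (1 + volX X))%:E)%E.
Proof.
move=> c1 c2 h; rewrite delta_distE mulrDr mulr1 EFinD leeD//; first exact: hdist_sup.
exact: L1dist_sup.
Qed.

Lemma delta_eq0 phi psi : contX X phi -> contX X psi ->
  (forall x, X x -> phi x = psi x) -> (delta_dist X phi psi <= 0)%E.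
Proof.
move=> c1 c2 h; rewrite -[leRHS]/(0%:E) -[0%R in leRHS](mul0r (1 + volX X)).
by apply: delta_sup => // x Xx; rewrite h// subrr normr0.
Qed.

Lemma hdist_le_delta phi psi : (hdist X phi psi <= delta_dist X phi psi)%E.
Proof. by rewrite delta_distE leeDl// L1dist_ge0. Qed.

Lemma L1dist_le_delta phi psi : (L1dist phi psi <= delta_dist X phi psi)%E.
Proof. by rewrite delta_distE leeDr// hdist_ge0. Qed.

Lemma r_le f g (e : \bar R) :
  (forall k, (0 < k)%N -> (delta_dist X (lower_env X k f) (lower_env X k g) <= e)%E /\
     (delta_dist X (upper_env X k f) (upper_env X k g) <= e)%E) ->
  (r_dist X f g <= e)%E.
Proof.
by move=> h; apply: ge_ereal_sup => _ [k /= k0 <-]; rewrite ge_max; apply/andP; exact: h.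
Qed.

Lemma delta_lower_le_r f g k : (0 < k)%N ->
  (delta_dist X (lower_env X k f) (lower_env X k g) <= r_dist X f g)%E.
Proof.
move=> k0; apply: le_ereal_sup_tmp; eexists; first by exists k.
by rewrite le_max lexx.
Qed.

Lemma delta_upper_le_r f g k : (0 < k)%N ->
  (delta_dist X (upper_env X k f) (upper_env X k g) <= r_dist X f g)%E.
Proof.
move=> k0; apply: le_ereal_sup_tmp; eexists; first by exists k.
by rewrite le_max lexx orbT.
Qed.

Lemma r_ge0 f g : (0 <= r_dist X f g)%E.
Proof. exact: le_trans (delta_ge0 _ _) (delta_lower_le_r f g (ltn0Sn 0)). Qed.

Lemma rC f g : r_dist X f g = r_dist X g f.
Proof.
have H f' g' : (r_dist X f' g' <= r_dist X g' f')%E.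
  apply: r_le => k k0; rewrite (deltaC (lower_env X k f')) (deltaC (upper_env X k f')).
  by split; [exact: delta_lower_le_r|exact: delta_upper_le_r].
by apply/eqP; rewrite eq_le; apply/andP; split; apply: H.
Qed.

Lemma contX_lower f k : Cae X f -> contX X (lower_env X k f).
Proof. by move=> cf; exact: contX_LipOn (lower_env_lip oX X0 k cf). Qed.

Lemma contX_upper f k : Cae X f -> contX X (upper_env X k f).
Proof. by move=> cf; exact: contX_LipOn (upper_env_lip oX X0 k cf). Qed.

Lemma r_tri f g h : Cae X f -> Cae X g -> Cae X h ->
  (r_dist X f h <= r_dist X f g + r_dist X g h)%E.
Proof.
move=> cf cg ch; apply: r_le => k k0; split.
  apply: le_trans (delta_tri (contX_lower cf) (contX_lower cg) (contX_lower ch)) _.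
  by apply: leeD; exact: delta_lower_le_r.
apply: le_trans (delta_tri (contX_upper cf) (contX_upper cg) (contX_upper ch)) _.
by apply: leeD; exact: delta_upper_le_r.
Qed.

Lemma r_fin f g : Cae X f -> Cae X g -> r_dist X f g \is a fin_num.
Proof.
move=> cf cg; rewrite ge0_fin_numE ?r_ge0//.
have [[M fM] _] := cf; have [[N gN] _] := cg.
apply: (@le_lt_trans _ _ ((M + N) * (1 + volX X))%:E); last exact: ltry.
have dMN (u v : R) : `|u| <= M -> `|v| <= N -> `|u - v| <= M + N.
  by move=> uM vN; rewrite (le_trans (ler_normB _ _))// lerD.
apply: r_le => k _; split; apply: delta_sup; do ?[exact: contX_lower|exact: contX_upper].
  by move=> x Xx; apply: dMN; exact: lower_env_bound.
by move=> x Xx; apply: dMN; exact: upper_env_bound.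
Qed.

Lemma null_setU (A B : set pt) : leb_outer A = 0%E -> leb_outer B = 0%E ->
  leb_outer (A `|` B) = 0%E.
Proof.
move=> A0 B0; apply/eqP; rewrite eq_le outer_measure_ge0 andbT.
apply: (@le_trans _ _ (leb_outer A + leb_outer B)%E); first exact: outer_measureU2.
by rewrite A0 B0 adde0.
Qed.

Lemma null_sub (A B : set pt) : A `<=` B -> leb_outer B = 0%E -> leb_outer A = 0%E.
Proof.
move=> AB B0; apply/eqP; rewrite eq_le outer_measure_ge0 andbT -B0.
exact: le_outer_measure.
Qed.

Lemma lower_env_aeq f f' k : aeq_on X f f' -> lower_env X k f = lower_env X k f'.
Proof.
move=> ff'; apply/funext => x; congr sup; apply/seteqP.
split=> _ [phi [phiL phif] <-]; exists phi => //; split=> //.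
- apply: null_sub (null_setU phif ff') => z [Xz zphi].
  by have [fz|nfz] := eqVneq (f z) (f' z); [left; rewrite /= fz|right].
- apply: null_sub (null_setU phif ff') => z [Xz zphi].
  by have [fz|nfz] := eqVneq (f z) (f' z); [left; rewrite /= -fz|right].
Qed.

Lemma aeq_opp f f' : aeq_on X f f' -> aeq_on X (fun x => - f x) (fun x => - f' x).
Proof. by apply: null_sub => z [Xz /=]; rewrite eqr_opp. Qed.

Lemma upper_env_aeq f f' k : aeq_on X f f' -> upper_env X k f = upper_env X k f'.
Proof.
by move=> ff'; apply/funext => x; rewrite !upper_envN (lower_env_aeq _ (aeq_opp ff')).
Qed.

Lemma r_aeq f f' g g' : aeq_on X f f' -> aeq_on X g g' -> r_dist X f g = r_dist X f' g'.
Proof.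
move=> ff' gg'; have H f1 f1' g1 g1' : aeq_on X f1 f1' -> aeq_on X g1 g1' ->
    (r_dist X f1 g1 <= r_dist X f1' g1')%E.
  move=> ff1 gg1; apply: r_le => k k0.
  rewrite (lower_env_aeq _ ff1) (lower_env_aeq _ gg1) (upper_env_aeq _ ff1) (upper_env_aeq _ gg1).
  by split; [exact: delta_lower_le_r|exact: delta_upper_le_r].
have sym f1 f1' : aeq_on X f1 f1' -> aeq_on X f1' f1.
  by apply: null_sub => z [Xz]; rewrite eq_sym.
by apply/eqP; rewrite eq_le; apply/andP; split; apply: H => //; apply: sym.
Qed.

(** At distance 0 all lower envelopes of positive slope agree on [X]; they converge to [f] and to
    [g] at common continuity points, which fill [X] up to a null set. *)
Lemma r_eq0 f g : Cae X f -> Cae X g -> (r_dist X f g = 0%E <-> aeq_on X f g).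
Proof.
move=> cf cg; split=> [r0|fg]; last first.
  have gg : aeq_on X g g.
    by apply: null_sub (outer_measure0 _) => x [_ /eqP].
  rewrite (r_aeq fg gg); apply/eqP; rewrite eq_le r_ge0 andbT.
  by apply: r_le => k _; split; apply: delta_eq0 => //;
    do ?[exact: contX_lower|exact: contX_upper].
have LE k x : (0 < k)%N -> X x -> lower_env X k f x = lower_env X k g x.
  move=> k0 Xx; apply/eqP; rewrite -subr_eq0 -normr_le0.
  apply/ler_addgt0Pr => e e0; rewrite add0r.
  have e1 : 0 < e / (1 + k%:R) by rewrite divr_gt0// ltr_pwDl.
  have [+ _] : graph_near (e / (1 + k%:R)) (lower_env X k f) (lower_env X k g) /\
      graph_near (e / (1 + k%:R)) (lower_env X k g) (lower_env X k f).
    apply: hdist_lt; apply: le_lt_trans (hdist_le_delta _ _) _.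
    by apply: le_lt_trans (delta_lower_le_r f g k0) _; rewrite r0 lte_fin.
  move=> /graph_near_LipOn/(_ (ler0n _ k) (lower_env_lip oX X0 k cg) Xx).
  by rewrite mulrC divfK// gt_eqF// ltr_pwDl.
have [_ f0] := cf; have [_ g0] := cg.
apply: null_sub (null_setU f0 g0) => z [Xz /eqP fg].
have [fz|] := pselect {for z, continuous f}; last by left.
have [gz|] := pselect {for z, continuous g}; last by right.
have Df : cpt X f z by []; have Dg : cpt X g z by [].
case: fg; apply/eqP; rewrite eq_le; apply/andP; split; apply/ler_addgt0Pr => e e0.
  have [K /(_ K.+1 (leqnSn K))] := lower_env_cvg oX X0 cf Df e0.
  by rewrite LE//; have := lower_env_le oX X0 K.+1 cg Dg; lra.
have [K /(_ K.+1 (leqnSn K))] := lower_env_cvg oX X0 cg Dg e0.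
by rewrite -LE//; have := lower_env_le oX X0 K.+1 cf Df; lra.
Qed.

End Distances.

(** * Completeness *)

Section Completeness.
Variables (R : realType) (n : nat).
Notation pt := 'rV[R]_n.
Variables (X : set pt) (oX : open X) (X0 : X !=set0) (bX : bounded_set X).
Implicit Types (f g h phi psi chi Phi : pt -> R).

Definition unif_lim (v : nat -> pt -> R) Phi := forall e : R, 0 < e ->
  exists N : nat, forall m, (N <= m)%N -> forall x, X x -> `|v m x - Phi x| <= e.

Lemma unif_cauchy_lim (v : nat -> pt -> R) :
  (forall e : R, 0 < e -> exists N : nat, forall m p, (N <= m)%N -> (N <= p)%N ->
     forall x, X x -> `|v m x - v p x| <= e) ->
  exists Phi, unif_lim v Phi.
Proof.
move=> cv.
have vx x : X x -> cvg (v m x @[m --> \oo]).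
  move=> Xx; apply: cauchy_cvg; apply: cauchy_exP => e e0.
  have e2 : 0 < e / 2 by rewrite divr_gt0.
  have [N hN] := cv _ e2; exists (v N x); exists N => // m /= Nm.
  by rewrite /ball/= (le_lt_trans (hN _ _ (leqnn N) Nm _ Xx))//; lra.
exists (fun x => lim (v m x @[m --> \oo])) => e e0.
have [N hN] := cv _ e0; exists N => m Nm x Xx.
apply/ler_addgt0Pr => d d0.
have /cvgrPdist_lt/(_ _ d0) := vx x Xx; move=> [P _ hP].
have /hP/= h1 : (P <= maxn N P)%N by exact: leq_maxr.
have h2 := hN _ _ Nm (leq_maxl N P) _ Xx.
by rewrite (le_trans (ler_distD (v (maxn N P) x) _ _))// lerD// distrC ltW.
Qed.

Lemma unif_lim_le v w Phi Psi x : unif_lim v Phi -> unif_lim w Psi -> X x ->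
  (forall m, v m x <= w m x) -> Phi x <= Psi x.
Proof.
move=> hv hw Xx vw; apply/ler_addgt0Pr => e e0; have e2 : 0 < e / 2 by rewrite divr_gt0.
have [N hN] := hv _ e2; have [P hP] := hw _ e2.
have := hN _ (leq_maxl N P) _ Xx; have := hP _ (leq_maxr N P) _ Xx.
have := vw (maxn N P); rewrite !ler_norml => ? /andP[? ?] /andP[? ?]; lra.
Qed.

Lemma unif_lim_LipOn v Phi (k : R) : unif_lim v Phi -> (forall m, LipOn X k (v m)) ->
  LipOn X k Phi.
Proof.
move=> hv vL x y Xx Xy; apply/ler_addgt0Pr => e e0; have e2 : 0 < e / 2 by rewrite divr_gt0.
have [N hN] := hv _ e2; have := hN _ (leqnn N) _ Xx; have := hN _ (leqnn N) _ Xy.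
have := vL N _ _ Xx Xy.
rewrite !ler_norml => /andP[? ?] /andP[? ?] /andP[? ?]; apply/andP; split; lra.
Qed.

Lemma unif_limN v Phi : unif_lim v Phi -> unif_lim (fun m x => - v m x) (fun x => - Phi x).
Proof.
move=> h e /h[N hN]; exists N => m Nm x Xx.
by rewrite -opprD normrN hN.
Qed.

Lemma graph_nearN (e : R) phi psi : graph_near X e phi psi ->
  graph_near X e (fun x => - phi x) (fun x => - psi x).
Proof.
move=> h x /h[y Xy xy]; exists y => //; move: xy; rewrite !edist1E/=.
by rewrite -opprD sqrrN.
Qed.

Lemma lower_env_opp f k : lower_env X k (fun x => - f x) = (fun x => - upper_env X k f x).
Proof. by apply/funext => x; rewrite upper_envN opprK. Qed.

Lemma upper_env_opp f k : upper_env X k (fun x => - f x) = (fun x => - lower_env X k f x).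
Proof.
apply/funext => x; rewrite upper_envN.
by rewrite (_ : (fun y => - - f y) = f)//; apply/funext => y; rewrite opprK.
Qed.

Lemma lower_env_lim_exists (u : nat -> pt -> R) : (forall m, Cae X (u m)) ->
  (forall e : R, 0 < e -> exists N : nat, forall m p, (N <= m)%N -> (N <= p)%N ->
     forall k, (0 < k)%N -> graph_near X e (lower_env X k (u m)) (lower_env X k (u p))) ->
  exists F : nat -> pt -> R, forall k, (0 < k)%N ->
    unif_lim (fun m => lower_env X k (u m)) (F k).
Proof.
move=> cu h.
have /choice[F hF] : forall k, exists Phi, (0 < k)%N ->
    unif_lim (fun m => lower_env X k (u m)) Phi.
  (* Only positive slopes enter [r_dist], so the limit for [k = 0] is filled in arbitrarily. *)
  move=> k; have [->|k0] := posnP k; first by exists (fun=> 0).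
  suff [Phi hPhi] : exists Phi, unif_lim (fun m => lower_env X k (u m)) Phi by exists Phi.
  apply: unif_cauchy_lim => e e0.
  have k1 : 0 < 1 + k%:R :> R by rewrite ltr_pwDl.
  have e1 : 0 < e / (1 + k%:R) by rewrite divr_gt0.
  have [N hN] := h _ e1; exists N => m p Nm Np x Xx.
  have := graph_near_LipOn (hN _ _ Nm Np k k0) (ler0n _ k) (lower_env_lip oX X0 k (cu p)) Xx.
  by rewrite mulrC divfK// gt_eqF.
by exists F.
Qed.

(* The lower envelopes of the limit are controlled through the UPPER envelopes of
   the sequence: a k-Lipschitz minorant of [f] lies below every [G j], hence, up to
   [(1 + k) e], below every upper envelope of [u m], hence below [u m]. *)
Lemma lower_env_limit (u F G : nat -> pt -> R) f k : (forall m, Cae X (u m)) -> Cae X f ->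
  (0 < k)%N -> unif_lim (fun m => lower_env X k (u m)) (F k) ->
  (forall e : R, 0 < e -> exists N : nat, forall m, (N <= m)%N -> forall j, (0 < j)%N ->
     graph_near X e (upper_env X j (u m)) (G j)) ->
  (forall j, (0 < j)%N -> LipOn X j%:R (G j)) ->
  (forall x, X x -> F k x <= f x) ->
  (forall j x, (0 < j)%N -> X x -> f x <= G j x) ->
  forall x, X x -> lower_env X k f x = F k x.
Proof.
move=> cu cf k0 FL GU GL Ff fG x Xx; apply/eqP; rewrite eq_le; apply/andP; split; last first.
  apply: le_lower_env => //; last by move=> z [Xz _]; exact: Ff.
  by apply: unif_lim_LipOn FL _ => m; exact: lower_env_lip.
have phiG j y : (0 < j)%N -> X y -> lower_env X k f y <= G j y.
  move=> j0 Xy; apply: (dense_le (cpt_dense oX cf)) => //.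
  - exact: contX_lower.
  - exact: (contX_LipOn oX (GL j j0)).
  - by move=> z Dz; rewrite (le_trans (lower_env_le oX X0 k cf Dz))// fG//; case: Dz.
apply/ler_addgt0Pr => e e0.
have k1 : 0 < 1 + k%:R :> R by rewrite ltr_pwDl.
(* A Hausdorff error [a] costs [a] in value and [k * a] when a [k]-Lipschitz function is carried to
   the neighbouring point; here [(1 + k) * a] is [e / 2]. *)
have e1 : 0 < e / 2 / (1 + k%:R) by rewrite !divr_gt0.
have [N hN] := GU _ e1; have e2 : 0 < e / 2 by rewrite divr_gt0.
have [P hP] := FL _ e2; set m := maxn N P.
have /hN Nm : (N <= m)%N by exact: leq_maxl.
have /hP/(_ _ Xx) Pm : (P <= m)%N by exact: leq_maxr.
suff : lower_env X k f x - e / 2 <= lower_env X k (u m) x.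
  by move: Pm; rewrite ler_norml => /andP[? ?] ?; lra.
apply: (@le_lower_env _ _ _ oX X0 (u m) k (fun y => lower_env X k f y - e / 2)) => //.
  move=> y z Xy Xz; rewrite (_ : _ - _ = lower_env X k f y - lower_env X k f z); last by ring.
  exact: lower_env_lip.
move=> z Dz; apply/ler_addgt0Pr => d d0.
(* The slope [K.+1] depends on [z] and [d], whereas [m] was fixed before: this is where Hausdorff
   closeness of the upper envelopes uniformly in the slope is indispensable. *)
have [K hK] := upper_env_cvg oX X0 (cu m) Dz d0.
have Uz := hK _ (leqnSn K).
have [y Xy zy] := Nm K.+1 isT z Dz.1.
have h1 := le_lt_trans (dist_le_edist1 _ _) zy.
have h2 := le_lt_trans (gap_le_edist1 _ _) zy.
have h3 := lower_env_lip oX X0 k cf Dz.1 Xy; have h4 := phiG K.+1 y isT Xy.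
rewrite /= in h1 h2; set a := e / 2 / (1 + k%:R) in h1 h2 e1.
have h5 : k%:R * dist z y <= k%:R * a by rewrite ler_wpM2l// ltW.
have h6 : e / 2 = a + k%:R * a by rewrite /a -[X in X + _]mul1r -mulrDl [RHS]mulrC divfK// gt_eqF.
move: h2 h3; rewrite ltr_norml ler_norml => /andP[? ?] /andP[? ?]; lra.
Qed.

(** Uniform convergence serves only to pick an auxiliary index [p]; the bound depends on [N] alone,
    so it is uniform in the slope even though the speed of convergence is not. *)
Lemma delta_unif_lim (v : nat -> pt -> R) Phi m N (e : R) :
  (forall m, contX X (v m)) -> contX X Phi -> unif_lim v Phi ->
  (N <= m)%N -> 0 < e ->
  (forall p, (N <= p)%N -> (delta_dist X (v m) (v p) <= e%:E)%E) ->
  (delta_dist X (v m) Phi <= (2 * e)%:E)%E.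
Proof.
move=> cv cP vP Nm e0 h.
have V1 : 0 < 1 + volX X by rewrite ltr_pwDl// volX_ge0.
have e1 : 0 < e / (1 + volX X) by rewrite divr_gt0.
have [P hP] := vP _ e1; set p := maxn N P.
apply: le_trans (delta_tri oX X0 (cv m) (cv p) cP) _.
rewrite (_ : 2 * e = e + e); last by ring.
rewrite EFinD leeD//; first by apply: h; exact: leq_maxl.
apply: le_trans (delta_sup oX bX (cv p) cP (hP p (leq_maxr _ _))) _.
by rewrite lee_fin divfK// gt_eqF.
Qed.

Section limit.
Variable u : nat -> pt -> R.
Hypothesis cu : forall m, Cae X (u m).
Hypothesis ru : forall e : R, 0 < e -> exists N : nat, forall m p : nat,
  (N <= m)%N -> (N <= p)%N -> (r_dist X (u m) (u p) < e%:E)%E.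

Let lower_near (e : R) : 0 < e -> exists N : nat, forall m p, (N <= m)%N -> (N <= p)%N ->
  forall k, (0 < k)%N -> graph_near X e (lower_env X k (u m)) (lower_env X k (u p)).
Proof.
move=> /ru[N hN]; exists N => m p Nm Np k k0.
suff /hdist_lt[] : (hdist X (lower_env X k (u m)) (lower_env X k (u p)) < e%:E)%E by [].
apply: le_lt_trans (hdist_le_delta _ _ _) _.
exact: le_lt_trans (delta_lower_le_r _ _ _ k0) (hN _ _ Nm Np).
Qed.

Let upper_near (e : R) : 0 < e -> exists N : nat, forall m p, (N <= m)%N -> (N <= p)%N ->
  forall k, (0 < k)%N -> graph_near X e (upper_env X k (u m)) (upper_env X k (u p)).
Proof.
move=> /ru[N hN]; exists N => m p Nm Np k k0.
suff /hdist_lt[] : (hdist X (upper_env X k (u m)) (upper_env X k (u p)) < e%:E)%E by [].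
apply: le_lt_trans (hdist_le_delta _ _ _) _.
exact: le_lt_trans (delta_upper_le_r _ _ _ k0) (hN _ _ Nm Np).
Qed.

Lemma envelope_limits : exists F G : nat -> pt -> R, forall k, (0 < k)%N ->
  unif_lim (fun m => lower_env X k (u m)) (F k) /\
  unif_lim (fun m => upper_env X k (u m)) (G k).
Proof.
have [F hF] := lower_env_lim_exists cu lower_near.
have [] := @lower_env_lim_exists (fun m x => - u m x).
- by move=> m; exact: CaeN.
- move=> e /upper_near[N hN]; exists N => m p Nm Np k k0.
  by rewrite !lower_env_opp; apply: graph_nearN; exact: hN.
move=> G hG; exists F, (fun k x => - G k x) => k k0; split; first exact: hF.
move=> e /(unif_limN (hG k k0))[N hN]; exists N => m /hN h x /h.
by rewrite lower_env_opp !opprK.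
Qed.

Variables F G : nat -> pt -> R.
Hypothesis FG : forall k, (0 < k)%N ->
  unif_lim (fun m => lower_env X k (u m)) (F k) /\
  unif_lim (fun m => upper_env X k (u m)) (G k).

Let FL k : (0 < k)%N -> LipOn X k%:R (F k).
Proof.
by move=> k0; apply: unif_lim_LipOn (FG k0).1 _ => m; exact: lower_env_lip.
Qed.

Let GL k : (0 < k)%N -> LipOn X k%:R (G k).
Proof.
by move=> k0; apply: unif_lim_LipOn (FG k0).2 _ => m; exact: upper_env_lip.
Qed.

Let F_le_G k j x : (0 < k)%N -> (0 < j)%N -> X x -> F k x <= G j x.
Proof.
move=> k0 j0 Xx; apply: (unif_lim_le (FG k0).1 (FG j0).2 Xx) => m.
exact: (lower_le_upper oX X0 _ _ (cu m)).
Qed.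

Let F_bound : exists B : R, forall k x, (0 < k)%N -> X x -> `|F k x| <= B.
Proof.
have [N hN] := lower_near ltr01; have [[M uM] _] := cu N.
(* One unit for the Hausdorff distance to the envelope of [u N], uniform in [k], and one for the
   passage to the limit. *)
exists (M + 2) => k x k0 Xx; have [P hP] := (FG k0).1 _ ltr01.
have h1 := hP _ (leq_maxr N P) _ Xx.
have [y Xy xy] := hN _ _ (leq_maxl N P) (leqnn N) k k0 x Xx.
have h2 := le_lt_trans (gap_le_edist1 _ _) xy.
have h3 := lower_env_bound oX X0 k (cu N) uM Xy.
move: h1 h2 h3; rewrite /= !ler_norml ltr_norml => /andP[? ?] /andP[? ?] /andP[? ?].
by apply/andP; split; lra.
Qed.

Let delta_limit (e : R) : 0 < e -> exists N : nat, forall m, (N <= m)%N -> forall k, (0 < k)%N ->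
  (delta_dist X (lower_env X k (u m)) (F k) <= (2 * e)%:E)%E /\
  (delta_dist X (upper_env X k (u m)) (G k) <= (2 * e)%:E)%E.
Proof.
move=> e0; have [N hN] := ru e0; exists N => m Nm k k0; split.
  apply: (@delta_unif_lim (fun m => lower_env X k (u m)) _ m N) => //.
  - by move=> p; exact: contX_lower.
  - exact: (contX_LipOn oX (FL k0)).
  - exact: (FG k0).1.
  - move=> p Np; apply: le_trans (delta_lower_le_r _ _ _ k0) _.
    by apply: ltW; exact: hN.
apply: (@delta_unif_lim (fun m => upper_env X k (u m)) _ m N) => //.
- by move=> p; exact: contX_upper.
- exact: (contX_LipOn oX (GL k0)).
- exact: (FG k0).2.
- move=> p Np; apply: le_trans (delta_upper_le_r _ _ _ k0) _.
  by apply: ltW; exact: hN.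
Qed.

(** Markov's inequality for [G k - F k] at a single large slope. First [N] is fixed, with envelopes
    of [u N] close to [F k] and [G k] in L1 for all [k]; only then is the slope chosen to make the
    gap of [u N] small. The three errors are 2, 1 and 2 fifths of [e]. *)
Let gap_null (d : R) : 0 < d ->
  leb_outer [set x | X x /\ forall k, (0 < k)%N -> d < G k x - F k x] = 0%E.
Proof.
move=> d0; apply/eqP; rewrite eq_le outer_measure_ge0 andbT.
rewrite -(@pmule_rle0 _ d%:E) ?lte_fin//; apply/lee_addgt0Pr => e e0; rewrite add0e.
have e5 : 0 < e / 5 by rewrite divr_gt0.
have [N /(_ _ (leqnn N)) hN] := delta_limit e5.
have [K hK] := env_gap_intX oX X0 bX (cu N) e5.
have [hL hU] := hN K.+1 isT; have hI := hK _ (leqnSn K).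
have cF := contX_LipOn oX (FL (ltn0Sn K)); have cG := contX_LipOn oX (GL (ltn0Sn K)).
have cGF := contXB cG cF.
apply: (@le_trans _ _ (d%:E * leb_outer [set x | X x /\ (d < G K.+1 x - F K.+1 x)%R])%E).
  rewrite lee_pmul2l ?lte_fin//; apply: le_outer_measure => x [Xx h]; split=> //; exact: h.
apply: le_trans (superlevel_null oX cGF _ d0) _.
  by move=> x Xx; rewrite subr_ge0 F_le_G.
have -> : intX X (fun x => G K.+1 x - F K.+1 x) = L1dist X (G K.+1) (F K.+1).
  apply: eq_integral => x /set_mem Xx; rewrite ger0_norm// subr_ge0.
  exact: F_le_G.
set L := lower_env X K.+1 (u N); set U := upper_env X K.+1 (u N).
have cL : contX X L by exact: contX_lower.
have cU : contX X U by exact: contX_upper.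
apply: le_trans (L1dist_tri oX cG cU cF) _.
apply: (@le_trans _ _ (L1dist X U (G K.+1) + (L1dist X U L + L1dist X L (F K.+1)))%E).
  by rewrite (L1distC _ U (G K.+1)); apply: leeD => //; exact: L1dist_tri.
rewrite (_ : e = 2 * (e / 5) + (e / 5 + 2 * (e / 5))); last by field.
rewrite !EFinD; apply: leeD; first exact: le_trans (L1dist_le_delta X0 _ _) hU.
apply: leeD; last exact: le_trans (L1dist_le_delta X0 _ _) hL.
apply: le_trans hI; rewrite le_eqVlt; apply/orP; left; apply/eqP.
apply: eq_integral => x /set_mem Xx; rewrite ger0_norm// subr_ge0.
exact: (lower_le_upper oX X0 _ _ (cu N)).
Qed.

Lemma cauchy_limit : exists f, Cae X f /\
  (forall e : R, 0 < e -> exists N : nat, forall m : nat,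
     (N <= m)%N -> (r_dist X (u m) f < e%:E)%E).
Proof.
have [B hB] := F_bound.
pose f x := sup [set F k.+1 x | k in setT].
have Ff k x : (0 < k)%N -> X x -> F k x <= f x.
  case: k => // k _ Xx; apply: ub_le_sup; last by exists k.
  by exists B => _ [j _ <-]; have := hB j.+1 x isT Xx; rewrite ler_norml => /andP[].
have fG j x : (0 < j)%N -> X x -> f x <= G j x.
  move=> j0 Xx; apply: ge_sup; first by exists (F 1 x); exists 0%N.
  by move=> _ [k _ <-]; exact: F_le_G.
have fB x : X x -> `|f x| <= B.
  move=> Xx; rewrite ler_norml; apply/andP; split.
    apply: le_trans (Ff 1%N x isT Xx).
    by have := hB 1%N x isT Xx; rewrite ler_norml => /andP[].
  apply: ge_sup; first by exists (F 1 x); exists 0%N.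
  by move=> _ [k _ <-]; have := hB k.+1 x isT Xx; rewrite ler_norml => /andP[].
have cf : Cae X f.
  split; first by exists B.
  (* Outside these countably many null sets, every tolerance is met by some [G k - F k]; the
     continuous functions [F k] and [G k] then squeeze [f], which forces continuity. *)
  apply: (@null_sub _ _ _ (\bigcup_j [set x | X x /\
      forall k, (0 < k)%N -> j.+1%:R^-1 < G k x - F k x])); last first.
    apply/eqP; rewrite eq_le outer_measure_ge0 andbT.
    apply: le_trans (outer_measure_sigma_subadditive _ _) _.
    by rewrite eseries0// => j _ _; apply: gap_null; rewrite invr_gt0.
  move=> x [Xx nf]; apply: contrapT => nx; apply: nf; apply/continuous_dist => e e0.
  have e3 : 0 < e / 3 by rewrite divr_gt0.
  have [j _ /(_ _ (leqnn j)) je] := near_infty_natSinv_lt (PosNum e3).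
  have [k [k0 kx]] : exists k, (0 < k)%N /\ G k x - F k x <= j.+1%:R^-1.
    apply: contrapT => nk; apply: nx; exists j => //; split=> // k k0.
    by rewrite ltNge; apply/negP => h; apply: nk; exists k.
  have /continuous_dist/(_ _ e3)[d1 d10 h1] := contX_LipOn oX (FL k0) Xx.
  have /continuous_dist/(_ _ e3)[d2 d20 h2] := contX_LipOn oX (GL k0) Xx.
  have /open_dist/(_ _ Xx)[d d0 xd] := oX.
  exists (Num.min d (Num.min d1 d2)); first by rewrite !lt_min d0 d10.
  move=> y; rewrite !lt_min => /and3P[/xd Xy /h1 + /h2].
  have := Ff _ _ k0 Xx; have := Ff _ _ k0 Xy; have := fG _ _ k0 Xx; have := fG _ _ k0 Xy.
  move: je kx; rewrite /= !ltr_norml; move: (j.+1%:R^-1 : R) => a ? ? ? ? ? ?.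
  by move=> /andP[? ?] /andP[? ?]; apply/andP; split; lra.
exists f; split=> //.
have GU (e : R) : 0 < e -> exists N : nat, forall m, (N <= m)%N -> forall k, (0 < k)%N ->
    graph_near X e (lower_env X k (u m)) (F k) /\ graph_near X e (upper_env X k (u m)) (G k).
  move=> e0; have e4 : 0 < e / 4 by rewrite divr_gt0.
  have [N hN] := delta_limit e4; exists N => m Nm k k0; have [h1 h2] := hN m Nm k k0.
  have e4e : 2 * (e / 4) < e by lra.
  split.
    suff /hdist_lt[] : (hdist X (lower_env X k (u m)) (F k) < e%:E)%E by [].
    by apply: le_lt_trans (le_trans (hdist_le_delta _ _ _) h1) _; rewrite lte_fin.
  suff /hdist_lt[] : (hdist X (upper_env X k (u m)) (G k) < e%:E)%E by [].
  by apply: le_lt_trans (le_trans (hdist_le_delta _ _ _) h2) _; rewrite lte_fin.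
have lowE k x : (0 < k)%N -> X x -> lower_env X k f x = F k x.
  move=> k0 Xx; apply: (@lower_env_limit u F G f k) => //.
  - exact: (FG k0).1.
  - move=> e /GU[N hN]; exists N => m Nm j j0.
    by have [] := hN m Nm j j0.
  - by move=> z; exact: Ff.
(* The same lemma for the negated sequence; negation exchanges the roles of [F] and [G]. *)
have upE k x : (0 < k)%N -> X x -> upper_env X k f x = G k x.
  move=> k0 Xx; rewrite upper_envN.
  apply/eqP; rewrite eqr_oppLR; apply/eqP.
  apply: (@lower_env_limit (fun m x => - u m x) (fun k x => - G k x) (fun k x => - F k x)
    (fun x => - f x) k (fun m => CaeN (cu m)) (CaeN cf) k0 _ _ _ _ _ x Xx).
  - move=> e /(unif_limN (FG k0).2)[N hN]; exists N => m /hN h y /h.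
    by rewrite lower_env_opp.
  - move=> e /GU[N hN]; exists N => m Nm j j0; rewrite upper_env_opp.
    by apply: graph_nearN; have [] := hN m Nm j j0.
  - by move=> j j0 y z Xy Xz; rewrite -opprD normrN; exact: FL.
  - by move=> z Xz; rewrite lerN2; exact: fG.
  - by move=> j z j0 Xz; rewrite lerN2; exact: Ff.
move=> e e0; have e4 : 0 < e / 4 by rewrite divr_gt0.
have [N hN] := delta_limit e4; exists N => m Nm.
apply: (@le_lt_trans _ _ (2 * (e / 4))%:E); last by rewrite lte_fin; lra.
apply: r_le => k k0; have [h1 h2] := hN m Nm k k0.
have cF := contX_LipOn oX (FL k0); have cG := contX_LipOn oX (GL k0).
split.
  apply: le_trans (delta_tri oX X0 (contX_lower oX X0 (cu m)) cF (contX_lower oX X0 cf)) _.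
  rewrite -[leRHS]adde0; apply: leeD => //.
  apply: delta_eq0 => //; first exact: contX_lower.
  by move=> x Xx; rewrite lowE.
apply: le_trans (delta_tri oX X0 (contX_upper oX X0 (cu m)) cG (contX_upper oX X0 cf)) _.
rewrite -[leRHS]adde0; apply: leeD => //.
apply: delta_eq0 => //; first exact: contX_upper.
by move=> x Xx; rewrite upE.
Qed.

End limit.
End Completeness.

(** * Density *)

Section Scales.
Variables (R : realType) (n : nat).
Notation pt := 'rV[R]_n.
Variables (X : set pt) (oX : open X) (X0 : X !=set0) (bX : bounded_set X).
Implicit Types (f g h phi : pt -> R) (x y z p : pt).

(** The distance to the complement of [X], capped at 1. The cap also gives a meaning to an empty
    complement, which occurs in dimension 0. *)
Definition dX : pt -> R := env setT (fun y => if `[< X y >] then 1 else 0) 1.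

Let setT0 : [set: pt] !=set0.
Proof. by exists 0. Qed.

Let ind_ge0 y : [set: pt] y -> - 0 <= (if `[< X y >] then 1 else 0) :> R.
Proof. by move=> _; rewrite oppr0; case: ifP. Qed.

Lemma dX_lip x y : dX x <= dX y + dist x y.
Proof.
have := env_lip setT0 ind_ge0 ler01 x y.
by rewrite mul1r ler_norml => /andP[? ?]; rewrite /dX; lra.
Qed.

Lemma dX_le1 x : X x -> dX x <= 1.
Proof.
move=> Xx; apply: le_trans (env_le_self ind_ge0 ler01 I) _.
by rewrite asboolT.
Qed.

Lemma dX_in x y : dist x y < dX x -> X y.
Proof.
move=> xy; apply: contrapT => nXy; move: xy; rewrite ltNge => /negP; apply.
by apply: le_trans (env_le ind_ge0 ler01 x (I : [set: pt] y)) _; rewrite asboolF// add0r mul1r.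
Qed.

Lemma dX_gt0 x : X x -> 0 < dX x.
Proof.
move=> Xx; have /open_dist/(_ _ Xx)[d d0 xd] := oX.
apply: (@lt_le_trans _ _ (Num.min 1 d)); first by rewrite lt_min ltr01.
apply: env_ge => // y _; rewrite mul1r ge_min; case: asboolP => Xy.
  by rewrite lerDl dist_ge0.
by rewrite add0r (_ : d <= _ = true) ?orbT// leNgt; apply/negP => /xd.
Qed.

(** A quantified peak: around [p], at distance at most [s x], there is a plateau as high, up to [e],
    as the values of [f] near [x], and the scale [t] is finer than its width [w] all around [x].
    Applied to [- f] it describes dips. *)
Definition wide (D : set pt) f (e : R) (s t : pt -> R) := forall x, X x ->
  exists p w, [/\ 0 < w, w <= s x, dist p x <= s x,
    forall z z', D z -> D z' -> dist z p <= 2 * w -> dist z' x <= w -> f z' - e <= f z &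
    forall y, dist x y <= 2 * s x -> t y <= w].

Section wide_scale.
Variables (D : set pt) (f s : pt -> R) (M e : R).
Hypotheses (DX : D `<=` X) (dD : dense_in X D) (fM : forall z, D z -> `|f z| <= M)
  (fc : forall z, D z -> {for z, continuous f}) (e0 : 0 < e)
  (s_lip : forall x y, s x <= s y + dist x y)
  (s_gt0 : forall x, X x -> 0 < s x) (s_le : forall x, X x -> s x <= dX x / 8).

Let P x w := [/\ 0 < w, w <= s x & exists2 p, dist p x <= s x &
  forall z z', D z -> D z' -> dist z p <= 2 * w -> dist z' x <= w -> f z' - e <= f z].

Let P_anti x w w' : 0 < w' -> w' <= w -> P x w -> P x w'.
Proof.
move=> w'0 w'w [w0 ws [p px h]]; split=> //; first exact: le_trans ws.
by exists p => // z z' Dz Dz' zp z'x; apply: h => //; lra.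
Qed.

(** Take [p] almost realizing the supremum of [f] on the ball of radius [2 * r] about [x0];
    continuity of [f] at [p] yields a plateau, which serves all [x] close to [x0] with the same
    width. *)
Let P_local x0 : X x0 -> exists w r, [/\ 0 < w, 0 < r & forall x, dist x0 x < r -> P x w].
Proof.
(* With [|x0 - x| < r], the scale [s x] is at least [3 * r], room enough for [p], which is within
   [2 * r] of [x0]. *)
move=> Xx0; pose r := s x0 / 4; have r0 : 0 < r by rewrite divr_gt0// s_gt0.
have rE : s x0 = 4 * r by rewrite /r; field.
clearbody r.
pose A := [set f z | z in [set z | D z /\ dist x0 z <= 2 * r]].
have supA : has_sup A.
  split.
    have [z Dz xz] := dD Xx0 r0; exists (f z); exists z => //; split=> //.
    by apply: ltW; lra.
  by exists M => _ [z [Dz _] <-]; have := fM Dz; rewrite ler_norml => /andP[].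
have e2 : 0 < e / 2 by rewrite divr_gt0.
have [_ [p [Dp px] <-] pS] := sup_adherent e2 supA.
have /continuous_dist/(_ _ e2)[w1 w10 hw1] := fc Dp.
exists (Num.min (w1 / 3) r), r; split=> //; first by rewrite lt_min r0 divr_gt0.
move=> x x0x; set w := Num.min _ _.
have ww1 : w <= w1 / 3 by rewrite /w ge_min lexx.
have wr : w <= r by rewrite /w ge_min lexx orbT.
have w0 : 0 < w by rewrite lt_min r0 divr_gt0.
clearbody w.
have sx : 3 * r <= s x by have := s_lip x0 x; lra.
split=> //; first by lra.
exists p.
  by have := dist_tri x0 p x; rewrite (distC p x0); lra.
move=> z z' Dz Dz' zp z'x.
have h1 : dist p z < w1 by rewrite distC; lra.
have := hw1 _ h1; rewrite ltr_norml => /andP[? ?].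
have : f z' <= sup A.
  apply: ub_le_sup; first by case: supA.
  exists z' => //; split=> //.
  by have := dist_tri x x0 z'; rewrite (distC x z'); lra.
lra.
Qed.

Let wb x := sup [set w | P x w].

Let wb_has x : X x -> has_sup [set w | P x w].
Proof.
move=> Xx; split; last by exists (s x) => w [].
by have [w [r [_ r0 h]]] := P_local Xx; exists w; apply: h; rewrite distxx.
Qed.

Let wb_ge x w : P x w -> w <= wb x.
Proof. by move=> Pw; apply: ub_le_sup => //; exists (s x) => ? []. Qed.

Let wb_gt0 x : X x -> 0 < wb x.
Proof.
move=> Xx; have [w [r [w0 r0 h]]] := P_local Xx.
by apply: lt_le_trans w0 (wb_ge (h x _)); rewrite distxx.
Qed.

Let wb_le x : X x -> wb x <= s x.
Proof. by move=> Xx; apply: ge_sup; [case: (wb_has Xx) | move=> w []]. Qed.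

Let wb_half x : X x -> P x (wb x / 2).
Proof.
move=> Xx; have w0 := wb_gt0 Xx; have w2 : 0 < wb x / 2 by rewrite divr_gt0.
have [w Pw ww] := sup_adherent w2 (wb_has Xx).
by apply: P_anti Pw => //; move: ww; rewrite -/(wb x); lra.
Qed.

Let closed_ball_compact y (r : R) : compact [set x | dist y x <= r].
Proof.
apply: bounded_closed_compact.
  exists (`|y| + r); split; first exact: num_real.
  move=> N yN x /= yx; apply: ltW; apply: le_lt_trans yN.
  have := norm_le_enorm (y - x); rewrite -/(dist y x) => h.
  by rewrite -[x](subKr y) (le_trans (ler_normB _ _))// lerD2l (le_trans h).
rewrite -openC; apply/open_dist => x /= /negP; rewrite -ltNge => yx.
exists (dist y x - r); first by rewrite subr_gt0.
move=> z xz; apply/negP; rewrite -ltNge.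
by have := dist_tri z y x; rewrite (distC z x); lra.
Qed.

Let P_uniform y : X y -> exists2 w, 0 < w & forall x, dist y x <= 3 / 5 * dX y -> P x w.
Proof.
move=> Xy; have := @closed_ball_compact y (3 / 5 * dX y).
move=> /compact_near_coveringP/(_ nat \oo (fun i x => P x (i.+1%:R^-1))).
case=> [x /= yx|N _ hN].
- have Xx : X x by apply: (@dX_in y); have := dX_gt0 Xy; lra.
  have [w [r [w0 r0 h]]] := P_local Xx.
  exists ([set z | dist x z < r], [set i | i.+1%:R^-1 < w]); last first.
    move=> [z i] /= [xz iw]; apply: P_anti (h _ xz); first by rewrite invr_gt0.
    exact: ltW.
  split; first by apply/nbhs_dist; exists r.
  exact: (near_infty_natSinv_lt (PosNum w0)).
by exists (N.+1%:R^-1); [rewrite invr_gt0 | exact: (hN N (leqnn N))].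
Qed.

(** [wb x] is the supremum of the admissible widths at [x]; half of it is certainly admissible. The
    infimum of the functions [F x] is Lipschitz and at most [wb x / 2] on the ball of radius
    [2 * s x] about [x]; only its positivity is delicate. *)
Lemma wide_scale : exists t, [/\ forall x y, t x <= t y + dist x y,
  forall x, X x -> 0 < t x, forall x, X x -> t x <= s x & wide D f e s t].
Proof.
pose F x y := (wb x + Num.max (dist x y - 2 * s x) 0) / 2.
have F0 x y : X x -> 0 <= F x y.
  by move=> Xx; rewrite divr_ge0// addr_ge0 ?(ltW (wb_gt0 Xx))// le_max lexx orbT.
pose t y := inf [set F x y | x in X].
have t_le x y : X x -> t y <= F x y.
  by move=> Xx; apply: ge_inf; [exists 0 => _ [z Xz <-]; exact: F0 | exists x].
have t_le' x y : X x -> dist x y <= 2 * s x -> t y <= wb x / 2.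
  move=> Xx xy; apply: le_trans (t_le x y Xx) _.
  by rewrite /F max_r ?addr0// subr_le0.
exists t; split.
- move=> x y; have := @inf_lip R n pt X F 1 0 X0 F0 _ x y.
  rewrite mul1r ler_norml => H; suff /H/andP[? ?] :
    forall i x y, X i -> F i x <= F i y + 1 * dist x y by rewrite /t; lra.
  move=> i u v Xi; rewrite mul1r /F.
  have := dist_tri v i u; have := dist_ge0 u v; rewrite (distC v u) => uv0 uv.
  suff : Num.max (dist i u - 2 * s i) 0 <= Num.max (dist i v - 2 * s i) 0 + dist u v by lra.
  rewrite ge_max; apply/andP; split.
    apply: (@le_trans _ _ (dist i v - 2 * s i + dist u v)); first by lra.
    by rewrite lerD2r le_max lexx.
  by rewrite addr_ge0// le_max lexx orbT.
(* Centres [x] within [3/5 * dX y] of [y] have widths bounded below by compactness. For the others,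
   [s x <= dX x / 8] gives [|x - y| - 2 s x >= 3/4 |x - y| - dX y / 4 >= dX y / 5]. *)
- move=> y Xy; have [w w0 hw] := P_uniform Xy; have d0 := dX_gt0 Xy.
  apply: (@lt_le_trans _ _ (Num.min w (dX y / 5) / 2)).
    by rewrite divr_gt0// lt_min w0 divr_gt0.
  apply: lb_le_inf; first by case: X0 => x Xx; exists (F x y); exists x.
  move=> _ [x Xx <-]; rewrite ler_pM2r ?invr_gt0//.
  have [yx|yx] := leP (dist y x) (3 / 5 * dX y).
    rewrite ge_min; apply/orP; left; apply: le_trans (wb_ge (hw x yx)) _.
    by rewrite lerDl le_max lexx orbT.
  rewrite ge_min; apply/orP; right.
  apply: (@le_trans _ _ (dist x y - 2 * s x)); last first.
    by rewrite -[leLHS]add0r lerD ?(ltW (wb_gt0 Xx))// le_max lexx.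
  have := s_le Xx; have := dX_lip x y; rewrite (distC x y); lra.
- move=> x Xx; apply: le_trans (t_le' x x Xx _) _.
    by rewrite distxx; have := s_gt0 Xx; lra.
  by have := wb_le Xx; have := wb_gt0 Xx; lra.
move=> x Xx; have [w0 ws [p px h]] := wb_half Xx.
by exists p, (wb x / 2); split=> // y; exact: t_le'.
Qed.

End wide_scale.

(** The intermediate value theorem along the segment from [x] to [x + v]. It trades a one-sided
    bound at the end point for a two-sided bound at a point still in [X]. *)
Lemma segment_value (psi : pt -> R) (K c c' : R) x v :
  (forall a b, `|psi a - psi b| <= K * dist a b) ->
  (forall t, 0 <= t <= 1 -> X (x + t *: v)) ->
  c <= psi x -> psi (x + v) <= c' -> c <= c' ->
  exists x', [/\ X x', dist x x' <= enorm v & c <= psi x' <= c'].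
Proof.
move=> psiL Xv cx xc' cc'.
have Xx : X x by have := Xv 0; rewrite scale0r addr0; apply; rewrite lexx ler01.
have [h|h] := leP (psi x) c'.
  by exists x; rewrite distxx sqrtr_ge0 cx h.
have K0 : 0 <= `|K| * enorm v by rewrite mulr_ge0// sqrtr_ge0.
pose q t := psi (x + t *: v).
have qL a b : `|q a - q b| <= `|K| * enorm v * `|a - b|.
  apply: le_trans (psiL _ _) _.
  rewrite /Defs.edist opprD addrACA subrr add0r -scalerBl enormZ.
  rewrite -mulrA [enorm v * _]mulrC ler_wpM2r ?ler_norm//.
  by rewrite mulr_ge0// sqrtr_ge0.
have qc : {within `[0, 1], continuous q}.
  apply: continuous_subspaceT => a; apply/cvgrPdist_lt => d d0.
  have k1 : 0 < `|K| * enorm v + 1 by rewrite ltr_wpDl.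
  near=> b; apply: le_lt_trans (qL _ _) _.
  have : `|a - b| < d / (`|K| * enorm v + 1).
    by near: b; apply: cvgr_dist_lt => //; rewrite divr_gt0.
  by rewrite ltr_pdivlMr//; have := normr_ge0 (a - b); nra.
have q01 : Num.min (q 0) (q 1) <= c' <= Num.max (q 0) (q 1).
  rewrite /q scale0r addr0 scale1r ge_min le_max xc' orbT/=.
  by rewrite (ltW h).
have [t] := IVT ler01 qc q01; rewrite in_itv/= => t01 qt.
exists (x + t *: v); split; first exact: Xv.
  rewrite dist_addv enormZ ger0_norm; last by have /andP[] := t01.
  by have /andP[? ?] := t01; rewrite -[leRHS]mul1r ler_wpM2r ?sqrtr_ge0.
by move: qt; rewrite /q => ->; rewrite cc' lexx.
Unshelve. all: by end_near. Qed.

End Scales.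

(** * Comparison of two envelopes of the same slope *)

Section Matching.
Variables (R : realType) (n : nat).
Notation pt := 'rV[R]_n.
Variables (X : set pt) (oX : open X).
Variables (E E' : set pt) (g g' : pt -> R) (M e k : R).
Hypotheses (EX : E `<=` X) (EX' : E' `<=` X) (E0 : E !=set0) (E'0 : E' !=set0)
  (dE : dense_in X E) (dE' : dense_in X E')
  (gM : forall z, E z -> `|g z| <= M) (gM' : forall z, E' z -> `|g' z| <= M)
  (e0 : 0 < e) (k0 : 0 < k) (M0 : 0 < M).

Let gN z : E z -> - M <= g z.
Proof. by move=> /gM; rewrite ler_norml => /andP[]. Qed.

Let gP z : E z -> g z <= M.
Proof. by move=> /gM; rewrite ler_norml => /andP[]. Qed.

Let gN' z : E' z -> - M <= g' z.
Proof. by move=> /gM'; rewrite ler_norml => /andP[]. Qed.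

Let gP' z : E' z -> g' z <= M.
Proof. by move=> /gM'; rewrite ler_norml => /andP[]. Qed.

(** The penalty is bounded because the envelope is at most [M] while [g] is at least [- M]. *)
Let near_min x : X x -> exists y, [/\ E y, k * dist x y <= 2 * M + e &
  g y + k * dist x y < env E g k x + e].
Proof.
move=> Xx; have [y Ey h] := env_near g k E0 x e0; exists y; split=> //.
by have := gN Ey; have := env_leM gN (ltW k0) dE Xx gP; lra.
Qed.

Lemma env_le_near x : X x ->
  (forall y, E y -> k * dist x y <= 2 * M + e ->
     exists2 z, E' z & g' z <= g y + e /\ k * dist y z <= e) ->
  env E' g' k x <= env E g k x + 3 * e.
Proof.
move=> Xx h; have [y [Ey xy hy]] := near_min Xx.
have [z Ez [gz yz]] := h y Ey xy.
apply: le_trans (env_le gN' (ltW k0) x Ez) _.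
have : k * dist x z <= k * dist x y + k * dist y z.
  by rewrite -mulrDr ler_wpM2l ?dist_tri// ltW.
lra.
Qed.

(* If [y] almost realizes the infimum at [x] and [z] is its partner in [E'], then
   translating [x] by [z - y] keeps the penalty [k |x - y|] unchanged; the
   intermediate value theorem on the segment then produces [x']. *)
Lemma env_match (s : pt -> R) x :
  X x -> (forall y, E y -> s y <= e / (4 * (M + e)) * dX X y) -> (forall y, E y -> s y <= e) ->
  (forall y, E y -> exists2 z, E' z & dist y z <= s y /\ g' z <= g y + e) ->
  env E g k x <= env E' g' k x ->
  exists2 x', X x' & dist x x' <= e /\ `|env E g k x - env E' g' k x'| <= 3 * e.
Proof.
move=> Xx sd se h xge; have e0' := e0; have M0' := M0; have [y [Ey xy hy]] := near_min Xx.
have [z Ez [yz gz]] := h y Ey.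
have [kyz|kyz] := leP (k * dist y z) e.
  exists x => //; rewrite distxx; split; first exact: ltW.
  have : env E' g' k x <= g' z + k * dist x z by apply: (env_le gN' (ltW k0)).
  have : k * dist x z <= k * dist x y + k * dist y z.
    by rewrite -mulrDr ler_wpM2l ?dist_tri// ltW.
  by move=> ? ?; rewrite ler_norml; apply/andP; split; lra.
(* Combined with [s y <= e / (4 * (M + e)) * dX X y], this makes [|x - y| + |y - z|] at most
   [dX X y / 2]: the whole translated segment stays in a ball about [y] contained in [X]. *)
have xyE : e * dist x y <= dist y z * (2 * M + e).
  apply: (@le_trans _ _ (k * dist y z * dist x y)).
    by rewrite ler_wpM2r ?dist_ge0// ltW.
  by rewrite mulrAC mulrC ler_wpM2l ?dist_ge0.
have Me : 0 < M + e by rewrite addr_gt0.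
have yzd : dist y z * (4 * (M + e)) <= e * dX X y.
  have : dist y z <= e / (4 * (M + e)) * dX X y by apply: le_trans (sd y Ey).
  by rewrite mulrAC ler_pdivlMr// mulr_gt0.
have dy : 0 < dX X y by apply: dX_gt0 => //; exact: EX.
have xyd : dist x y + dist y z < dX X y.
  rewrite -(ltr_pM2l e0); have ed : 0 < e * dX X y by rewrite mulr_gt0.
  have := dist_ge0 y z; nra.
have [|||x' [Xx' xx' hx']] := @segment_value R n X (env E' g' k) k (env E g k x)
    (env E g k x + 2 * e) x (z - y) (env_lip E'0 gN' (ltW k0)) _ xge.
- move=> t /andP[t0 t1]; apply: (@dX_in _ _ _ y); apply: le_lt_trans xyd.
  apply: le_trans (dist_tri x _ _) _; rewrite distC lerD2l dist_addv enormZ.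
  rewrite ger0_norm// (distC y z) /Defs.edist -[leRHS]mul1r ler_wpM2r ?sqrtr_ge0//.
- apply: le_trans (env_le gN' (ltW k0) _ Ez) _.
  rewrite (_ : dist (x + (z - y)) z = dist x y); first lra.
  by rewrite -[in RHS](distDr (z - y)); congr (dist _ _); rewrite addrC subrK.
- by rewrite lerDl mulr_ge0// ltW.
exists x' => //; split.
  apply: le_trans xx' _; rewrite -/(dist z y) distC.
  by apply: le_trans yz _; exact: se.
by have /andP[? ?] := hx'; rewrite ler_norml; apply/andP; split; lra.
Qed.

(* Either the scale [1 / k] is small with respect to the plateau of [g] around [p],
   which then carries over to the envelope at [p], or it is so large that the
   displacements [s] are negligible at [x] itself. *)
Lemma env_peak (s t r : pt -> R) x p w :
  X x -> (forall x, X x -> 0 < r x) -> (forall x, X x -> r x < dX X x) ->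
  (forall x, X x -> r x <= e) ->
  (forall x y, r x <= r y + dist x y) -> (forall y, X y -> t y <= r y) ->
  (forall y, X y -> s y <= e / (4 * (M + e)) * t y) ->
  (forall y, E y -> exists2 z, E' z & dist y z <= s y /\ g' z <= g y + e) ->
  0 < w -> dist p x <= r x -> (forall y, dist x y <= 2 * r x -> t y <= w) ->
  (forall y, E y -> dist y p <= w -> env E' g' k x - 2 * e <= g y) ->
  env E g k x <= env E' g' k x ->
  exists2 x', X x' & dist x x' <= e /\ `|env E' g' k x - env E g k x'| <= 3 * e.
Proof.
move=> Xx r_gt0 r_dX r_e r_lip tr st h w0 px tw plateau xle.
have e0' := e0; have M0' := M0.
have Me : 0 < 4 * (M + e) by rewrite mulr_gt0// addr_gt0.
(* If [k * w >= 2 * M], a point farther than [w] from [p] pays a penalty that exceeds the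
   oscillation, so the envelope at [p] sees the plateau only. *)
have [kw|kw] := leP (2 * M) (k * w).
  have hp : env E' g' k x - 2 * e <= env E g k p.
    apply: env_ge => // y Ey; have [yp|yp] := leP (dist y p) w.
      apply: le_trans (plateau y Ey yp) _; rewrite lerDl mulr_ge0 ?dist_ge0//.
      exact: ltW.
    have : k * w <= k * dist p y by rewrite distC ler_wpM2l// ltW.
    have := gN Ey; have := env_leM gN' (ltW k0) dE' Xx gP'; lra.
  have [|||||x' [Xx' xx' hx']] := @segment_value R n X (fun y => - env E g k y) k
      (- env E' g' k x) (- env E' g' k x + 2 * e) x (p - x).
  - by move=> a b; rewrite -opprD normrN; exact: (env_lip E0 gN (ltW k0)).
  - move=> a /andP[a0 a1]; apply: (@dX_in _ _ _ x); rewrite dist_addv enormZ ger0_norm//.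
    apply: le_lt_trans (r_dX x Xx); apply: le_trans px.
    by rewrite -[leRHS]mul1r ler_wpM2r ?sqrtr_ge0.
  - by rewrite lerN2.
  - by rewrite addrC subrK; lra.
  - by rewrite lerDl mulr_ge0// ltW.
  exists x' => //; split; first by apply: le_trans xx' (le_trans px (r_e x Xx)).
  by have /andP[? ?] := hx'; rewrite ler_norml; apply/andP; split; lra.
exists x => //; rewrite distxx; split; first exact: ltW.
suff : env E' g' k x <= env E g k x + 3 * e.
  by move=> ?; rewrite ler_norml; apply/andP; split; lra.
apply: env_le_near => // y Ey xy; have [z Ez [yz gz]] := h y Ey.
exists z => //; split=> //; rewrite leNgt; apply/negP => kyz.
have Xy := EX Ey.
have yzt : dist y z * (4 * (M + e)) <= e * t y.
  have : dist y z <= e / (4 * (M + e)) * t y by apply: le_trans yz (st y Xy).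
  by rewrite mulrAC ler_pdivlMr.
(* Near [x], [t y <= w] and [k * w < 2 * M] bound [k |y - z|] by [e]. Far from [x], the choice of
   [s] gives [2 |x - y| <= t y <= r y <= r x + |x - y|], contradicting [|x - y| > 2 r x]. *)
have [xy2|xy2] := leP (dist x y) (2 * r x).
  have tyw := tw y xy2.
  have : k * (dist y z * (4 * (M + e))) <= k * (e * w).
    by rewrite ler_wpM2l ?(ltW k0)// (le_trans yzt)// ler_wpM2l// ltW.
  have : e * (k * w) < e * (2 * M) by rewrite ltr_pM2l.
  have : e * (4 * (M + e)) < k * dist y z * (4 * (M + e)) by rewrite ltr_pM2r.
  have := mulr_gt0 e0 M0; have := mulr_gt0 e0 e0; nra.
have xyE : e * dist x y <= dist y z * (2 * M + e).
  apply: (@le_trans _ _ (k * dist y z * dist x y)).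
    by rewrite ler_wpM2r ?dist_ge0// ltW.
  by rewrite mulrAC mulrC ler_wpM2l ?dist_ge0.
have : e * (2 * dist x y) <= e * t y by have := dist_ge0 y z; nra.
rewrite ler_pM2l// => xyt.
have := tr y Xy; have := r_lip y x; have := r_gt0 x Xx; rewrite distC; lra.
Qed.

End Matching.

(** * The approximant with variable slope *)

Section Density.
Variables (R : realType) (n : nat).
Notation pt := 'rV[R]_n.
Variables (X : set pt) (oX : open X) (X0 : X !=set0) (bX : bounded_set X).
Implicit Types (f g h phi : pt -> R) (x y z p : pt).

Lemma dist_bounded : exists2 B : R, 0 < B & forall x y, X x -> X y -> dist x y <= B.
Proof.
have [N N0 XN] := ex_strict_bound_gt0 bX.
exists (n.+1%:R * (N + N)); first by rewrite mulr_gt0// addr_gt0.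
move=> x y Xx Xy; apply: le_trans (enorm_le_norm _) _.
rewrite ler_wpM2l// (le_trans (ler_normB _ _))// lerD//; apply: ltW; exact: XN.
Qed.

Lemma env_slope_le (E : set pt) g M (a b B : R) y : E !=set0 ->
  (forall z, E z -> - M <= g z) -> 0 <= a -> 0 <= b -> (forall z, E z -> dist y z <= B) ->
  env E g a y <= env E g b y + `|a - b| * B.
Proof.
move=> E0 gM a0 b0 yB; rewrite -lerBlDr; apply: env_ge => // z Ez.
have h1 := env_le gM a0 y Ez.
have : (a - b) * dist y z <= `|a - b| * B.
  apply: (@le_trans _ _ (`|a - b| * dist y z)); last by rewrite ler_wpM2l// yB.
  by rewrite ler_wpM2r ?dist_ge0// ler_norm.
rewrite mulrBl; lra.
Qed.

Lemma env_slope_mono (E : set pt) g M (a b : R) y : E !=set0 ->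
  (forall z, E z -> - M <= g z) -> 0 <= a -> a <= b -> env E g a y <= env E g b y.
Proof.
move=> E0 gM a0 ab; apply: env_ge => // z Ez; apply: le_trans (env_le gM a0 y Ez) _.
by rewrite lerD2l ler_wpM2r// dist_ge0.
Qed.

Lemma contX_inv (h : pt -> R) (B : R) : 0 < B -> (forall x, X x -> 0 < h x) ->
  (forall x y, h x <= h y + dist x y) -> contX X (fun x => B / h x).
Proof.
move=> B0 h0 hL x Xx; apply/continuous_dist => d d0; have a0 := h0 x Xx.
exists (Num.min (h x / 2) (d * h x ^+ 2 / (2 * B))).
  rewrite lt_min divr_gt0//= divr_gt0//; first by rewrite mulr_gt0// exprn_gt0.
  by rewrite mulr_gt0.
move=> y; rewrite lt_min => /andP[xy1 xy2].
have b0 : h x / 2 < h y by have := hL x y; lra.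
have hb0 : 0 < h y by apply: lt_trans b0; rewrite divr_gt0.
have ab : `|h y - h x| <= dist x y.
  by rewrite ler_norml; have := hL x y; have := hL y x; rewrite (distC y x) => ? ?;
     apply/andP; split; lra.
rewrite (_ : B / h x - B / h y = B * (h y - h x) / (h x * h y)); last first.
  by field; rewrite !gt_eqF.
rewrite normrM normrM (gtr0_norm B0) normfV (gtr0_norm (mulr_gt0 a0 hb0)).
rewrite ltr_pdivrMr ?mulr_gt0//.
move: xy2; rewrite ltr_pdivlMr ?mulr_gt0// => xy2.
have : `|h y - h x| * B <= dist x y * B by rewrite ler_wpM2r// ltW.
have : d * h x * (h x / 2) < d * h x * h y by rewrite ltr_pM2l// mulr_gt0.
rewrite expr2 in xy2; lra.
Qed.

(** Two errors: moving the point at fixed slope, and changing the slope at fixed point, which costs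
    at most the change of slope times the diameter bound of [X]. *)
Lemma contX_env_slope (E : set pt) g M (kap : pt -> R) : E !=set0 -> E `<=` X ->
  (forall z, E z -> - M <= g z) -> (forall x, X x -> 0 <= kap x) -> contX X kap ->
  contX X (fun x => env E g (kap x) x).
Proof.
move=> E0 EX gM kap0 ck x Xx; have [B B0 hB] := dist_bounded.
have /open_dist/(_ _ Xx)[d1 d10 xd1] := oX.
apply/continuous_dist => e e0; have e2B : 0 < e / 2 / B by rewrite !divr_gt0.
have /continuous_dist/(_ _ e2B)[d d0 hd] := ck x Xx.
have k1 : 0 < kap x + 1 by have := kap0 x Xx; lra.
exists (Num.min d1 (Num.min d (e / 2 / (kap x + 1)))).
  by rewrite !lt_min d10 d0 !divr_gt0.
move=> y; rewrite !lt_min => /and3P[/xd1 Xy /hd hk]; rewrite ltr_pdivlMr// => hxy.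
have h1 := env_lip E0 gM (kap0 x Xx) x y.
have hE z : E z -> dist y z <= B by move=> Ez; apply: hB => //; exact: EX.
have h2 := env_slope_le E0 gM (kap0 x Xx) (kap0 y Xy) hE.
have h3 := env_slope_le E0 gM (kap0 y Xy) (kap0 x Xx) hE.
rewrite (distrC (kap y)) in h3; rewrite ltr_pdivlMr// in hk.
move: h1; rewrite ler_norml ltr_norml => /andP[? ?].
have := dist_ge0 x y; have := kap0 x Xx => ? ?.
by apply/andP; split; lra.
Qed.

Lemma C0b_Cae phi : C0b X phi -> Cae X phi.
Proof.
move=> [bp cp]; split=> //; rewrite (_ : [set _ | _] = set0) ?outer_measure0//.
by apply/seteqP; split=> // x [Xx nc]; case: nc; exact: cp.
Qed.

Lemma cptC0b phi : C0b X phi -> cpt X phi = X.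
Proof. by move=> [_ cp]; apply/seteqP; split=> [x []//|x Xx]; split=> //; exact: cp. Qed.

Lemma lower_env_minorant f phi k x : Cae X f -> C0b X phi ->
  (forall z, cpt X f z -> phi z <= f z) -> X x ->
  lower_env X k phi x <= lower_env X k f x.
Proof.
move=> cf Cphi phif; have cphi := C0b_Cae Cphi.
apply: (le_lower_env oX X0 cf (lower_env_lip oX X0 k cphi)) => z Dz.
apply: le_trans (phif z Dz); apply: (lower_env_le oX X0 k cphi).
by rewrite cptC0b//; case: Dz.
Qed.

(** Every point of [X] is a continuity point of [phi], but [phi] is compared with [f] on [cpt X f]
    only; density and continuity bridge the difference. *)
Lemma minorant_le_upper_env f phi k x : Cae X f -> C0b X phi ->
  (forall z, cpt X f z -> phi z <= f z) -> X x -> phi x <= upper_env X k f x.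
Proof.
move=> cf Cphi phif Xx.
apply: (dense_le (cpt_dense oX cf) _ _ _ Xx); first exact: Cphi.2.
  exact: (contX_upper oX X0 cf).
by move=> z Dz; apply: le_trans (phif z Dz) _; exact: (upper_env_ge oX X0 k cf).
Qed.

Lemma upper_env_minorant f phi k x : Cae X f -> C0b X phi ->
  (forall z, cpt X f z -> phi z <= f z) -> X x ->
  upper_env X k phi x <= upper_env X k f x.
Proof.
move=> cf Cphi phif; rewrite !upper_envN lerN2.
apply: (le_lower_env oX X0 (CaeN (C0b_Cae Cphi)) (lower_env_lip oX X0 k (CaeN cf))).
move=> z [Xz _]; rewrite -[leLHS]opprK -upper_envN lerN2.
exact: minorant_le_upper_env.
Qed.

(* The approximant is an envelope of [f] whose slope [kap] blows up at the boundary of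
   [X], at a rate dictated by the widths of the peaks and of the dips of [f]: the dips
   are resolved at scale [t1], the peaks at the much finer scale [t2]. *)
Lemma density_aux f (M e : R) (K : nat) : Cae X f -> (forall x, X x -> `|f x| <= M) ->
  1 <= M -> 0 < e -> e <= 1 -> (0 < K)%N ->
  exists phi, [/\ C0b X phi, forall z, cpt X f z -> phi z <= f z,
    forall x, X x -> lower_env X K f x <= phi x &
    forall k : nat, (0 < k)%N ->
     [/\ graph_near X (5 * e) (lower_env X k f) (lower_env X k phi),
         graph_near X (5 * e) (lower_env X k phi) (lower_env X k f),
         graph_near X (5 * e) (upper_env X k f) (upper_env X k phi),
         graph_near X (5 * e) (upper_env X k phi) (upper_env X k f) &
         (k <= K)%N -> forall x, X x ->
           lower_env X k f x <= lower_env X k phi x + 3 * e /\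
           upper_env X k f x <= upper_env X k phi x + 3 * e]].
Proof.
move=> cf fM M1 e0 e1 K0.
have M0 : 0 < M by lra.
set D := cpt X f; have dD : dense_in X D := cpt_dense oX cf.
have D0 : D !=set0 := cpt_neq0 oX X0 cf.
have DX : D `<=` X by move=> z [].
have fD z : D z -> `|f z| <= M by move=> /DX; exact: fM.
have fN z : D z -> - M <= f z by move=> /fD; rewrite ler_norml => /andP[].
have e2 : 0 < e / 2 by rewrite divr_gt0.
pose c := e / (4 * (M + e)); have Me : 0 < 4 * (M + e) by lra.
have c0 : 0 < c by rewrite divr_gt0.
have c8 : c <= 8^-1 by rewrite ler_pdivrMr//; lra.
have K1 : 0 < K%:R + 1 :> R by rewrite ltr_wpDl.
(* Displacements of at most [a] change a penalty of slope at most [K] by at most [e]. *)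
pose a := e / (K%:R + 1); have a0 : 0 < a by rewrite divr_gt0.
have Ka : K%:R * a <= e.
  by rewrite /a mulrCA -[leRHS]mulr1 ler_wpM2l ?(ltW e0)// ler_pdivrMr// mul1r lerDl.
have ae : a <= e by rewrite ler_pdivrMr// -[leLHS]mulr1 ler_wpM2l ?(ltW e0)// lerDr.
have a1 : a <= 1 := le_trans ae e1.
have ca : c * a <= 8^-1.
  by rewrite -[leRHS]mulr1; apply: ler_pM => //; exact: ltW.
have caca : c * a <= c by rewrite -[leRHS]mulr1; apply: ler_wpM2l => //; exact: ltW.
have caa : c * a <= a.
  by rewrite -[leRHS]mul1r ler_wpM2r ?(ltW a0)// (le_trans c8)// invf_le1 ?ler1n.
(* The scales are nested: [eta = c * t2], [t2 <= s2 = c * t1], [t1 <= s1 = c * a * dX]. Lower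
   envelopes involve displacements [eta], small against the peak widths [t2]; upper envelopes
   involve displacements [s2], the distance to a peak, small against the dip widths [t1]. *)
pose s1 x := c * a * dX X x.
have ca0 : 0 < c * a by rewrite mulr_gt0.
have s1L x y : s1 x <= s1 y + dist x y.
  have := dX_lip X x y; have := dist_ge0 x y => ? ?.
  have : c * a * dX X x <= c * a * (dX X y + dist x y) by rewrite ler_wpM2l// ltW.
  by rewrite /s1; nra.
have s10 x : X x -> 0 < s1 x by move=> Xx; rewrite mulr_gt0// dX_gt0.
have s18 x : X x -> s1 x <= dX X x / 8.
  by move=> Xx; rewrite /s1 mulrC ler_wpM2l// ltW// dX_gt0.
have [t1 [t1L t10 t1s W1]] := wide_scale oX X0 (f := fun x => - f x) (M := M) dD
  (fun z Dz => eq_ind_r (fun u => u <= M) (fD z Dz) (normrN _))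
  (fun z Dz => continuous_opp Dz.2) e2 s1L s10 s18.
pose s2 x := c * t1 x.
have s2L x y : s2 x <= s2 y + dist x y.
  have := t1L x y; have := dist_ge0 x y => ? ?.
  have : c * t1 x <= c * (t1 y + dist x y) by rewrite ler_wpM2l// ltW.
  by rewrite /s2; nra.
have s20 x : X x -> 0 < s2 x by move=> Xx; rewrite mulr_gt0// t10.
have s2t1 x : X x -> s2 x <= t1 x by move=> Xx; have := t10 x Xx; rewrite /s2; nra.
have s2s1 x : X x -> s2 x <= s1 x.
  by move=> Xx; apply: le_trans (t1s x Xx); exact: s2t1.
have s28 x : X x -> s2 x <= dX X x / 8 by move=> Xx; apply: le_trans (s18 x Xx); exact: s2s1.
have [t2 [t2L t20 t2s W2]] := wide_scale oX X0 (f := f) (M := M) dD fD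
  (fun z Dz => Dz.2) e2 s2L s20 s28.
pose eta x := c * t2 x.
have etaL x y : eta x <= eta y + dist x y.
  have := t2L x y; have := dist_ge0 x y => ? ?.
  have : c * t2 x <= c * (t2 y + dist x y) by rewrite ler_wpM2l// ltW.
  by rewrite /eta; nra.
have eta0 x : X x -> 0 < eta x by move=> Xx; rewrite mulr_gt0// t20.
have etat2 x : X x -> eta x <= t2 x by move=> Xx; have := t20 x Xx; rewrite /eta; nra.
have etas2 x : X x -> eta x <= s2 x.
  by move=> Xx; apply: le_trans (t2s x Xx); exact: etat2.
have s1cd x : X x -> s1 x <= c * dX X x.
  by move=> Xx; rewrite /s1 ler_wpM2r// ltW// dX_gt0.
have s1a x : X x -> s1 x <= a.
  move=> Xx; apply: le_trans caa; rewrite /s1 -[leRHS]mulr1 ler_wpM2l ?(ltW ca0)//.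
  exact: dX_le1.
have s1e x : X x -> s1 x <= e by move=> Xx; apply: le_trans (s1a x Xx) ae.
have s1d x : X x -> s1 x < dX X x by move=> Xx; have := s18 x Xx; have := dX_gt0 oX Xx; lra.
(* Near-minimizers for [phi x] have penalty at most [2 * M + e]; this slope confines them to
   distance [eta x]. *)
pose kap x := (2 * M + e) / eta x.
have kap0 x : X x -> 0 < kap x by move=> Xx; rewrite divr_gt0 ?eta0//; lra.
have Kkap x : X x -> K%:R <= kap x.
  move=> Xx; rewrite ler_pdivlMr ?eta0//; apply: (@le_trans _ _ (K%:R * a)).
    by rewrite ler_wpM2l// (le_trans (etas2 x Xx))// (le_trans (s2s1 x Xx))// s1a.
  by apply: le_trans Ka _; lra.
pose phi x := env D f (kap x) x.
have phiN x : X x -> - M <= phi x by move=> Xx; apply: env_geN => //; exact: ltW (kap0 x Xx).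
have phiM x : X x -> phi x <= M.
  move=> Xx; apply: (env_leM fN (ltW (kap0 x Xx)) dD Xx) => z /fD.
  by rewrite ler_norml => /andP[].
have phiB x : X x -> `|phi x| <= M by move=> Xx; rewrite ler_norml phiN// phiM.
have phif z : D z -> phi z <= f z.
  by move=> Dz; apply: (env_le_self fN (ltW (kap0 z (DX z Dz)))).
have Cphi : C0b X phi.
  split; first by exists M.
  apply: (@contX_env_slope _ _ M) => //; first by move=> x Xx; exact: ltW (kap0 x Xx).
  by apply: contX_inv => //; lra.
have cphi := C0b_Cae Cphi.
have LK x : X x -> lower_env X K f x <= phi x.
  by move=> Xx; rewrite lower_envE//; apply: (env_slope_mono _ D0 fN) => //; exact: Kkap.
have nearphi y : X y -> exists2 z, D z & dist y z <= eta y /\ f z <= phi y + e / 2.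
  move=> Xy; have [z Dz h] := env_near f (kap y) D0 y e2; exists z => //.
  have ky := kap0 y Xy; have kd : 0 <= kap y * dist y z by rewrite mulr_ge0 ?dist_ge0// ltW.
  split; last by move: h; rewrite -/(phi y); lra.
  have : kap y * dist y z <= 2 * M + e.
    by have := fN z Dz; have := phiM y Xy; move: h; rewrite -/(phi y); lra.
  by rewrite /kap mulrAC ler_pdivrMr ?eta0// ler_pM2l//; lra.
have wideX (s : pt -> R) x p : (forall x, X x -> s x <= s1 x) -> X x ->
    dist p x <= s x -> X p.
  move=> ss1 Xx px; apply: (@dX_in _ _ _ x); rewrite distC.
  by apply: le_lt_trans px _; apply: le_lt_trans (ss1 x Xx) _; exact: s1d.
(* At the peak [p] near [y], the point realizing [phi p] up to [e / 2] lies within [eta p <= w] of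
   [p], hence on the plateau, where [f] is at least [f y - e / 2]. *)
have nearf y : D y -> exists2 z, X z & dist y z <= s2 y /\ - phi z <= - f y + e.
  move=> Dy; have Xy := DX y Dy; have [p [w [w0 ws px h tw]]] := W2 y Xy.
  have Xp : X p by exact: (wideX s2 y p s2s1 Xy px).
  exists p => //; split; first by rewrite distC.
  have [z Dz [pz fz]] := nearphi p Xp.
  have etaw : eta p <= w.
    apply: le_trans (etat2 p Xp) (tw p _).
    by rewrite distC; have := s20 y Xy; lra.
  have zp : dist z p <= 2 * w by rewrite distC; lra.
  have yy : dist y y <= w by rewrite distxx ltW.
  by have := h z y Dz Dy zp yy; lra.
have nearphi' y : X y -> exists2 z, D z & dist y z <= eta y /\ f z <= phi y + e.
  by move=> /nearphi[z Dz [yz fz]]; exists z => //; split=> //; lra.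
exists phi; split=> // k k0.
have kR : 0 < k%:R :> R by rewrite ltr0n.
have dXX : dense_in X X by move=> x d Xx d0; exists x; rewrite ?distxx.
have LE x : X x -> lower_env X k f x = env D f k%:R x by move=> Xx; rewrite lower_envE.
have LphiE x : X x -> lower_env X k phi x = env X phi k%:R x.
  by move=> Xx; rewrite lower_envE// cptC0b.
have UE x : X x -> upper_env X k f x = - env D (fun x => - f x) k%:R x.
  by move=> Xx; rewrite upper_envN (lower_envE oX X0 k (CaeN cf) Xx) cptN.
have UphiE x : X x -> upper_env X k phi x = - env X (fun x => - phi x) k%:R x.
  by move=> Xx; rewrite upper_envN (lower_envE oX X0 k (CaeN cphi) Xx) cptN cptC0b.
have Lle x : X x -> env X phi k%:R x <= env D f k%:R x.
  by move=> Xx; rewrite -LE// -LphiE//; exact: lower_env_minorant.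
have Ule x : X x -> env D (fun x => - f x) k%:R x <= env X (fun x => - phi x) k%:R x.
  by move=> Xx; rewrite -lerN2 -UE// -UphiE//; exact: upper_env_minorant.
have fD' z : D z -> `|- f z| <= M by rewrite normrN; exact: fD.
have phiB' z : X z -> `|- phi z| <= M by rewrite normrN; exact: phiB.
have ed x : X x -> eta x <= c * dX X x.
  by move=> Xx; apply: le_trans (s1cd x Xx); apply: le_trans (s2s1 x Xx); exact: etas2.
have s2d x : D x -> s2 x <= c * dX X x.
  by move=> /DX Xx; apply: le_trans (s1cd x Xx); exact: s2s1.
have etae x : X x -> eta x <= e.
  by move=> Xx; apply: le_trans (s1e x Xx); apply: le_trans (s2s1 x Xx); exact: etas2.
have s2e x : X x -> s2 x <= e by move=> Xx; apply: le_trans (s1e x Xx); exact: s2s1.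
have toG (u v : pt -> R) : (forall x, X x ->
     exists2 x', X x' & dist x x' <= e /\ `|u x - v x'| <= 3 * e) -> graph_near X (5 * e) u v.
  move=> h x Xx; have [x' Xx' [h1 h2]] := h x Xx; exists x' => //.
  by apply: le_lt_trans (edist1_le _ _) _; rewrite /=; lra.
split.
(* The envelope of [phi] may be too low at [x]; a peak of [f] supplies a nearby point where it is
   high enough. For [y] within [w] of [p], the near-minimizer for [phi y] stays within [2 * w] of
   [p], whence the factor 2 in [wide]. *)
- apply: toG => x Xx; rewrite LE//.
  have [p [w [w0 ws px h tw]]] := W2 x Xx.
  have [|x' Xx' [h1 h2]] := @env_peak R n X X D phi f M e k%:R (fun=> id) X0 dXX dD phiB fD
    e0 kR M0 eta t2 s2 x p w Xx s20 (fun x Xx => le_lt_trans (s2s1 x Xx) (s1d x Xx))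
    s2e s2L t2s (fun y _ => lexx _) nearphi' w0 px tw _ (Lle x Xx); last first.
    by exists x' => //; rewrite LphiE.
  move=> y Xy yp; have [z Dz [yz fz]] := nearphi y Xy.
  have etaw : eta y <= w.
    apply: le_trans (etat2 y Xy) (tw y _).
    by have := dist_tri p x y; rewrite (distC x p) (distC p y); lra.
  have zp : dist z p <= 2 * w by have := dist_tri y z p; rewrite (distC z y); lra.
  suff : env D f k%:R x <= phi y + 2 * e by lra.
  apply/ler_addgt0Pr => d d0.
  have m0 : 0 < Num.min w (d / k%:R) by rewrite lt_min w0 divr_gt0.
  have [z' Dz' ] := dD _ _ Xx m0; rewrite lt_min ltr_pdivlMr// => /andP[xz1 xz2].
  have := h z z' Dz Dz' zp; rewrite distC => /(_ (ltW xz1)) hz.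
  have := env_le fN (ltW kR) x Dz'; lra.
- apply: toG => x Xx; rewrite LphiE//.
  have [x' Xx' [h1 h2]] := @env_match R n X oX X D phi f M e k%:R (fun=> id) X0 D0 dXX phiB fD
    e0 kR M0 eta x Xx ed etae nearphi' (Lle x Xx).
  by exists x' => //; rewrite LE.
- apply: toG => x Xx; rewrite UE//.
  have [x' Xx' [h1 h2]] := @env_match R n X oX D X (fun x => - f x) (fun x => - phi x) M e k%:R
    DX D0 X0 dD fD' phiB' e0 kR M0 s2 x Xx s2d (fun y Dy => s2e y (DX y Dy)) nearf (Ule x Xx).
  by exists x' => //; rewrite UphiE// -opprD normrN.
(* The mirror case: a dip of [f], given by [W1], with displacements [s2]. *)
- apply: toG => x Xx; rewrite UphiE//.
  have [p [w [w0 ws px h tw]]] := W1 x Xx.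
  have [|x' Xx' [h1 h2]] := @env_peak R n X D X (fun x => - f x) (fun x => - phi x) M e k%:R
    DX D0 dD dXX fD' phiB' e0 kR M0 s2 t1 s1 x p w Xx s10 s1d s1e s1L t1s
    (fun y _ => lexx _) nearf w0 px tw _ (Ule x Xx); last first.
    by exists x' => //; rewrite UE// -opprD normrN.
  move=> y Dy yp; have [z' Dz' [xz' fz']] := nearphi x Xx.
  have etaw : eta x <= w.
    apply: le_trans (etas2 x Xx) _; apply: le_trans (s2t1 x Xx) (tw x _).
    by rewrite distxx; have := s10 x Xx; lra.
  have yp2 : dist y p <= 2 * w by lra.
  have z'x : dist z' x <= w by rewrite distC; exact: le_trans etaw.
  have phiN' z : X z -> - M <= - phi z by move=> /phiM; rewrite lerN2.
  have := env_le_self phiN' (ltW kR) Xx; have := h y z' Dy Dz' yp2 z'x; lra.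
move=> kK x Xx; rewrite LE// LphiE// UE// UphiE//.
have kKR : k%:R <= K%:R :> R by rewrite ler_nat.
have small (t : R) : 0 <= t -> t <= a -> k%:R * t <= e.
  by move=> t0 ta; apply: le_trans Ka; rewrite ler_pM.
split.
  apply: (@env_le_near R n X X D phi f M e k%:R) => // y Xy _.
  have [z Dz [yz fz]] := nearphi' y Xy; exists z => //; split=> //.
  apply: small; rewrite ?dist_ge0// (le_trans yz)// (le_trans (etas2 y Xy))//.
  by rewrite (le_trans (s2s1 y Xy))// s1a.
suff : env X (fun x => - phi x) k%:R x <= env D (fun x => - f x) k%:R x + 3 * e by lra.
apply: (@env_le_near R n X D X (fun x => - f x) (fun x => - phi x) M e k%:R) => // y Dy _.
have [z Xz [yz fz]] := nearf y Dy; exists z => //; split=> //.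
have Xy := DX y Dy.
by apply: small; rewrite ?dist_ge0// (le_trans yz)// (le_trans (s2s1 y Xy))// s1a.
Qed.

Lemma density f (eps : R) : Cae X f -> 0 < eps ->
  exists phi, C0b X phi /\ (r_dist X f phi < eps%:E)%E.
Proof.
move=> cf eps0; have [[M' fM'] _] := cf.
pose M := Num.max M' 1; have M1 : 1 <= M by rewrite le_max lexx orbT.
have fM x : X x -> `|f x| <= M by move=> /fM' h; rewrite le_max h.
have V0 : 0 <= volX X by exact: volX_ge0.
(* The Hausdorff part costs [5 * e]; the integral costs [3 * e * volX X] for [k <= K] and [e] for
   [k > K]. The factor 2 makes the final inequality strict. *)
pose e := Num.min 1 (eps / (2 * (6 + 3 * volX X))).
have V6 : 0 < 6 + 3 * volX X by lra.
have e0 : 0 < e by rewrite lt_min ltr01 divr_gt0// mulr_gt0.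
have e1 : e <= 1 by rewrite ge_min lexx.
have eeps : (6 + 3 * volX X) * e < eps.
  have : e <= eps / (2 * (6 + 3 * volX X)) by rewrite ge_min lexx orbT.
  by rewrite ler_pdivlMr ?mulr_gt0//; lra.
have [K' hK'] := env_gap_intX oX X0 bX cf e0.
pose K := K'.+1; have hK : (intX X (fun x => upper_env X K f x - lower_env X K f x)%R <= e%:E)%E.
  by apply: hK'; exact: leqnSn.
have [phi [Cphi phif LK h]] := density_aux cf fM M1 e0 e1 (ltn0Sn K').
exists phi; split=> //; have cphi := C0b_Cae Cphi.
apply: (@le_lt_trans _ _ ((6 + 3 * volX X) * e)%:E); last by rewrite lte_fin.
(* For [k > K], the envelopes of both [f] and [phi] lie between the [K]-th lower and upper envelopes
   of [f], because [phi] lies above that lower envelope; the gap integral then bounds their L1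
   distance. *)
have D (u v : pt -> R) (k : nat) : contX X u -> contX X v ->
    graph_near X (5 * e) u v -> graph_near X (5 * e) v u ->
    (forall x, X x -> v x <= u x) ->
    ((k <= K)%N -> forall x, X x -> u x <= v x + 3 * e) ->
    ((K < k)%N -> forall x, X x -> u x - v x <= upper_env X K f x - lower_env X K f x) ->
    (delta_dist X u v <= ((6 + 3 * volX X) * e)%:E)%E.
  move=> cu cv g1 g2 vu small large; rewrite delta_distE.
  have hu := hdist_le g1 g2.
  rewrite (_ : (6 + 3 * volX X) * e = 5 * e + (e + 3 * e * volX X)); last by ring.
  rewrite EFinD; apply: leeD => //.
  have eV : 0 <= 3 * e * volX X by rewrite !mulr_ge0// ltW.
  have [kK|Kk] := leqP k K.
    apply: le_trans (L1dist_sup (c := 3 * e) oX bX cu cv _) _.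
      move=> x Xx; rewrite ger0_norm ?subr_ge0 ?vu//.
      by rewrite lerBlDl; exact: small.
    by rewrite lee_fin; lra.
  apply: (@le_trans _ _ e%:E); last by rewrite lee_fin lerDl.
  apply: le_trans hK; apply: intX_le => //.
  - exact: contX_absB.
  - by apply: contXB; [exact: contX_upper|exact: contX_lower].
  - move=> x Xx; rewrite normr_ge0/= ger0_norm ?subr_ge0 ?vu//; exact: large.
apply: r_le => k k0; have [g1 g2 g3 g4 small] := h k k0.
split.
- apply: (D _ _ k) => //; [exact: contX_lower|exact: contX_lower| | |].
  + by move=> x; exact: lower_env_minorant.
  + by move=> kK x Xx; have [] := small kK x Xx.
  + move=> Kk x Xx; apply: lerB; first exact: lower_le_upper.
    apply: le_lower_env => //; last by move=> z [Xz _]; exact: LK.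
    by apply: LipOn_le (lower_env_lip oX X0 K cf); rewrite ler_nat ltnW.
- apply: (D _ _ k) => //; [exact: contX_upper|exact: contX_upper| | |].
  + by move=> x; exact: upper_env_minorant.
  + by move=> kK x Xx; have [] := small kK x Xx.
  + move=> Kk x Xx; apply: lerB; first by apply: upper_env_mono => //; exact: ltnW.
    by apply: le_trans (LK x Xx) _; apply: upper_env_ge => //; rewrite cptC0b.
Qed.

End Density.

Theorem theorem2p2 (R : realType) (n : nat) (X : set 'rV[R]_n) :
  X !=set0 -> open X -> bounded_set X ->
  (* r is well defined on equivalence classes *)
  (forall f f' g g', Cae X f -> Cae X f' -> Cae X g -> Cae X g' ->
     aeq_on X f f' -> aeq_on X g g' -> r_dist X f g = r_dist X f' g') /\
  (* r is a (finite-valued) metric on C_ae(X,R) *)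
  (forall f g, Cae X f -> Cae X g -> r_dist X f g \is a fin_num) /\
  (forall f g, Cae X f -> Cae X g -> (r_dist X f g = 0%E <-> aeq_on X f g)) /\
  (forall f g, Cae X f -> Cae X g -> r_dist X f g = r_dist X g f) /\
  (forall f g h, Cae X f -> Cae X g -> Cae X h ->
     (r_dist X f h <= r_dist X f g + r_dist X g h)%E) /\
  (* completeness *)
  (forall u : nat -> 'rV[R]_n -> R, (forall m, Cae X (u m)) ->
     (forall e : R, 0 < e -> exists N : nat, forall m p : nat,
         (N <= m)%N -> (N <= p)%N -> (r_dist X (u m) (u p) < e%:E)%E) ->
     exists f, Cae X f /\
       (forall e : R, 0 < e -> exists N : nat, forall m : nat,
          (N <= m)%N -> (r_dist X (u m) f < e%:E)%E)) /\
  (* density of (classes of) bounded continuous functions *)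
  (forall f, Cae X f -> forall e : R, 0 < e ->
     exists phi, C0b X phi /\ (r_dist X f phi < e%:E)%E).
Proof.
move=> X0 oX bX.
split; first by move=> f f' g g' _ _ _ _; exact: r_aeq.
split; first by move=> f g; exact: r_fin.
split; first by move=> f g; exact: r_eq0.
split; first by move=> f g _ _; exact: rC.
split; first by move=> f g h; exact: r_tri.
split; last by move=> f cf e e0; exact: density.
move=> u cu ru; have [F [G FG]] := envelope_limits oX X0 cu ru.
exact: (cauchy_limit oX X0 bX cu ru FG).
Qed.
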